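(* Let $c\ge 2$ be an integer, suppose that every agent $i\in N$ has a $\{1,c\}$-SUB valuation $v_i$, and let $p<1$ be a finite real number with $p\ne0$. For all sufficiently large $M$, the Bivalued Yankee Swap algorithm, run with the gain function $$\phi(X,i,d)=\begin{cases}(v_i(X_i)+d)^p-v_i(X_i)^p & \text{if } p\in(0,1)\text{ and }v_i(X_i)>0,\\ v_i(X_i)^p-(v_i(X_i)+d)^p & \text{if } p<0\text{ and }v_i(X_i)>0,\\ Md & \text{if } v_i(X_i)=0,\end{cases}$$ computes a max $p$-mean welfare allocation, i.e. an allocation $X$ that maximizes $|P_X|$, where $P_X=\{i\in N:v_i(X_i)>0\}$, and, subject to that, maximizes $\left(\frac1n\sum_{i\in P_X}v_i(X_i)^p\right)^{1/p}$.
   Context: **Setting.** $N=\{1,\dots,n\}$ is a set of agents and $G$ a finite set of $m$ goods. Write $S+g=S\cup\{g\}$, $S-g=S\setminus\{g\}$, $N+0=N\cup\{0\}$. For $v:2^G\to\mathbb{R}_{\ge0}$ let $\Delta_v(S,g)=v(S+g)-v(S)$. $v$ is $\{1,c\}$-SUB if $v(\emptyset)=0$; $\Delta_v(S,g)\in\{1,c\}$ for all $S\subseteq G$, $g\in G\setminus S$; and $\Delta_v(S,g)\ge\Delta_v(T,g)$ for all $S\subseteq T\subseteq G$, $g\in G\setminus T$. An allocation $X=(X_0,X_1,\dots,X_n)$ is a partition of $G$ into $n+1$ (possibly empty) bundles; $X_i$ goes to agent $i\in N$ and $X_0$ is unallocated. **Clean allocations and exchange graph.** The dummy agent $0$ has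 valuation $v_0(S)=c|S|$. For $i\in N+0$ let $\beta_i(S)=\max\{|T|:T\subseteq S,\ v_i(T)=c|T|\}$. An allocation $X$ is clean if $\beta_i(X_i)=|X_i|$ for all $i\in N+0$. For a clean allocation $X$, the exchange graph $\mathcal G(X)$ is the directed graph on $G$ with an edge $g\to g'$ if $g\in X_j$ and $\beta_j(X_j-g+g')=\beta_j(X_j)$ for some $j\in N+0$. $F_i(X)=\{g\in G:\beta_i(X_i+g)-\beta_i(X_i)=1\}$. For a clean allocation $X^c$ and a tuple $X^1=(X^1_1,\dots,X^1_n)$ of disjoint subsets of $X^c_0$, $X^c\cup X^1$ denotes the allocation giving $X^c_i\cup X^1_i$ to each $i\in N$ and leaving the rest unallocated. **Bivalued Yankee Swap with gain function $\phi$.** Initialize $X^c=(G,\emptyset,\dots,\emptyset)$, $X^1=(\emptyset,\dots,\emptyset)$, $U=N$. While $\sum_{h\in N}|X^1_h|<|X^c_0|$, perform one iteration: let $\mathrm{Gain}_c=\max_{k\in U}\phi(X^c\cup X^1,k,c)$ ($-\infty$ if $U=\emptyset$) and $\mathrm{Gain}_1=\max_{k\in N\setminus U}\phi(X^c\cup X^1,k,1)$ ($-\infty$ if $N\setminus U=\emptyset$). - If $\mathrm{Gain}_c\ge\mathrm{Gain}_1$: choose the smallest-index $i\in U$ attaining $\mathrm{Gain}_c$. If there is a path in $\mathcal G(X^c)$ from $F_i(X^c)$ to $X^c_0$, take a shortest such path $(g'_1,\dots,g'_t)$ and update $X^c$ by moving $g'_{s+1}$ to the bundle that contained $g'_s$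 for $1\le s<t$, and moving $g'_1$ to $X^c_i$ (so $g'_t$ leaves $X^c_0$); if $g'_t\in X^1_j$ for some $j\in N$, replace $X^1_j$ by $X^1_j-g'_t+g$ for an arbitrary $g\in X^c_0\setminus\bigcup_{h\in N}X^1_h$. If no such path exists, remove $i$ from $U$. - If $\mathrm{Gain}_c<\mathrm{Gain}_1$: choose the smallest-index $i\in N\setminus U$ attaining $\mathrm{Gain}_1$ and add to $X^1_i$ an arbitrary $g\in X^c_0\setminus\bigcup_{h\in N}X^1_h$. When the loop ends, output $X^c\cup X^1$. *)

(* Defs.v *)
From HB Require Import structures.
From mathcomp Require Import all_boot all_order all_algebra.
From mathcomp Require Import all_classical all_reals all_analysis.

Set Implicit Arguments.
Unset Strict Implicit.
Unset Printing Implicit Defensive.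

Import Order.TTheory GRing.Theory Num.Theory.
Import numFieldNormedType.Exports.

Local Open Scope ring_scope.

Definition marginal (R : realType) (G : finType) (v : {set G} -> R)
  (S : {set G}) (g : G) : R := v (g |: S) - v S.

Definition oneC_SUB (R : realType) (G : finType) (c : nat)
    (v : {set G} -> R) : Prop :=
  [/\ forall S, 0 <= v S,
      v finset.set0 = 0,
      forall (S : {set G}) (g : G), g \notin S ->
        marginal v S g = 1 \/ marginal v S g = c%:R
    & forall (S T : {set G}) (g : G), S \subset T -> g \notin T ->
        marginal v T g <= marginal v S g].

(* The agents are 'I_n, and N + 0 is option 'I_n with None as agent 0.  An    *)
(* ordered partition of G into n + 1 possibly empty bundles is the function   *)
(* sending each good to its owner, None meaning unallocated.                  *)
Definition allocation (n : nat) (G : finType) := {ffun G -> option 'I_n}.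

Definition bundle (n : nat) (G : finType) (X : allocation n G)
  (j : option 'I_n) : {set G} := [set g | X g == j].

(* A tuple (X^1_1, .., X^1_n) of disjoint subsets of X^c_0 is also encoded by *)
(* an element X1 of allocation n G, where X1 g = None means that g belongs to *)
(* none of the X^1_i; X1 takes precedence over Xc below because its goods are *)
(* unallocated in Xc.                                                         *)
Definition alloc_union (n : nat) (G : finType) (Xc X1 : allocation n G) :
    allocation n G :=
  [ffun g => if X1 g is Some i then Some i else Xc g].

Section ExchangeGraph.
Variables (R : realType) (n : nat) (G : finType) (c : nat).
Variable v : 'I_n -> {set G} -> R.

Definition ext_valuation (j : option 'I_n) (S : {set G}) : R :=
  if j is Some i then v i S else c%:R * #|S|%:R.

Definition beta (j : option 'I_n) (S : {set G}) : nat :=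
  (\max_(T : {set G} |
     (T \subset S) && (ext_valuation j T == (c%:R * #|T|%:R)%R)) #|T|)%N.

Definition exchange_edge (X : allocation n G) : rel G := fun g g' =>
  [exists j : option 'I_n, (g \in bundle X j) &&
     (beta j (g' |: (bundle X j :\ g)) == beta j (bundle X j))].

Definition improving (X : allocation n G) (j : option 'I_n) : {set G} :=
  [set g | (beta j (g |: bundle X j) - beta j (bundle X j))%N == 1%N].

(* The path is g :: q. *)
Definition exchange_path (X : allocation n G) (i : 'I_n) (g : G) (q : seq G) :
    bool :=
  [&& g \in improving X (Some i), path (exchange_edge X) g q
    & last g q \in bundle X None].

Definition shortest_exchange_path (X : allocation n G) (i : 'I_n) (g : G)
    (q : seq G) : Prop :=
  exchange_path X i g q /\
  forall g' q', exchange_path X i g' q' -> (size q <= size q')%N.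

(* The k-th good of the path goes to the k-th entry of                        *)
(* i :: (former owners of the goods of the path).                             *)
Definition augment (X : allocation n G) (i : 'I_n) (s : seq G) :
    allocation n G :=
  [ffun g => if g \in s then nth None (Some i :: map X s) (index g s)
             else X g].

End ExchangeGraph.

Record ys_state (n : nat) (G : finType) := YsState {
  ys_clean : allocation n G;
  ys_extra : allocation n G;
  ys_active : {set 'I_n} }.

Section YankeeSwap.
Variables (R : realType) (n : nat) (G : finType) (c : nat).
Variable v : 'I_n -> {set G} -> R.
Variable phi : allocation n G -> 'I_n -> R -> R.
Implicit Types s : ys_state n G.

Definition ys_init : ys_state n G :=
  YsState [ffun=> None] [ffun=> None] [set: 'I_n].

Definition ys_output s : allocation n G :=
  alloc_union (ys_clean s) (ys_extra s).

Definition ys_continue s : bool :=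
  (\sum_(h < n) #|bundle (ys_extra s) (Some h)|
     < #|bundle (ys_clean s) None|)%N.

(* The maximum over the empty set is -oo. *)
Definition max_gain s (A : {set 'I_n}) (d : R) : \bar R :=
  (\big[maxe/-oo]_(k in A) (phi (ys_output s) k d)%:E)%E.

Definition first_max_gain s (A : {set 'I_n}) (d : R) (i : 'I_n) : Prop :=
  let attains k := (k \in A) /\ (phi (ys_output s) k d)%:E = max_gain s A d in
  attains i /\ forall k, attains k -> (i <= k)%N.

Definition prefer_c s : bool :=
  (max_gain s (~: ys_active s) 1 <= max_gain s (ys_active s) c%:R)%E.

Definition free_good s (g : G) : bool :=
  (ys_clean s g == None) && (ys_extra s g == None).

(* replace_extra s z X1 : X1 is a possible new value of X^1 once z has left   *)
(* X^c_0.                                                                     *)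
Definition replace_extra s (z : G) (X1 : allocation n G) : Prop :=
  if ys_extra s z is Some j then
    exists2 g, free_good s g &
      X1 = [ffun x => if x == z then None
                      else if x == g then Some j else ys_extra s x]
  else X1 = ys_extra s.

(* One iteration of the loop; its choices of a shortest path and of goods are *)
(* nondeterministic.                                                          *)
Inductive ys_step s : ys_state n G -> Prop :=
| YsAugment i g q X1 of
    prefer_c s & first_max_gain s (ys_active s) c%:R i
    & shortest_exchange_path c v (ys_clean s) i g q
    & replace_extra s (last g q) X1 :
    ys_step s (YsState (augment (ys_clean s) i (g :: q)) X1 (ys_active s))
| YsDeactivate i of
    prefer_c s & first_max_gain s (ys_active s) c%:R i
    & (forall g q, ~~ exchange_path c v (ys_clean s) i g q) :
    ys_step s (YsState (ys_clean s) (ys_extra s) (ys_active s :\ i))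
| YsExtra i g of
    ~~ prefer_c s & first_max_gain s (~: ys_active s) 1 i & free_good s g :
    ys_step s (YsState (ys_clean s)
                 [ffun x => if x == g then Some i else ys_extra s x]
                 (ys_active s)).

(* Total correctness: whatever choices are made from s on, the loop never     *)
(* gets stuck, ends after finitely many iterations, and its output satisfies  *)
(* Q.                                                                         *)
Inductive ys_computes_from (Q : allocation n G -> Prop) s : Prop :=
| YsDone of ~~ ys_continue s & Q (ys_output s)
| YsLoop of ys_continue s & (exists s', ys_step s s')
    & (forall s', ys_step s s' -> ys_computes_from Q s').

Definition yankee_swap_computes (Q : allocation n G -> Prop) : Prop :=
  ys_computes_from Q ys_init.

End YankeeSwap.

Section PMeanWelfare.
Variables (R : realType) (n : nat) (G : finType).
Variable v : 'I_n -> {set G} -> R.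
Variable p : R.
Implicit Types X : allocation n G.

Definition utility X (i : 'I_n) : R := v i (bundle X (Some i)).

Definition positive_agents X : {set 'I_n} := [set i | 0 < utility X i].

Definition p_mean_welfare X : R :=
  (n%:R^-1 * \sum_(i in positive_agents X) utility X i `^ p) `^ p^-1.

Definition max_p_mean_welfare X : Prop :=
  (forall Y, (#|positive_agents Y| <= #|positive_agents X|)%N) /\
  (forall Y, #|positive_agents Y| = #|positive_agents X| ->
     p_mean_welfare Y <= p_mean_welfare X).

(* Meant for p < 1 with p != 0, so that the last branch is the case p < 0. *)
Definition p_mean_gain (M : R) X (i : 'I_n) (d : R) : R :=
  if utility X i == 0 then M * d
  else if 0 < p then (utility X i + d) `^ p - utility X i `^ p
  else utility X i `^ p - (utility X i + d) `^ p.

End PMeanWelfare.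

(* Main.v *)
Require Import Defs.
From mathcomp Require Import all_classical all_reals all_analysis.
From mathcomp Require Import all_boot all_order all_algebra.
From mathcomp Require Import zify ring lra.

Set Implicit Arguments.
Unset Strict Implicit.
Unset Printing Implicit Defensive.

Import Order.TTheory GRing.Theory Num.Theory.
Import numFieldNormedType.Exports.

(* A {1,c}-SUB valuation is v(S) = |S| + (c - 1) beta(S) with beta a matroid
   rank function, so an allocation yields the utilities c a_i + b_i, where a is
   the size vector of a clean allocation and b counts the remaining goods.
   Two facts from matroid theory drive the proof: transferring goods along a
   shortest exchange path keeps the allocation clean, and the size vectors of
   clean allocations satisfy an exchange property, proved by looking at the
   goods reachable from F_i.

   Giving a positive utility u the welfare u^p (-u^p when p < 0) and utility 0
   the welfare -M, with M large, makes welfare concave and its maximization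
   lexicographic, and comparing gains phi compares welfare increments.  The
   invariant is that every allocation Y has at most the welfare of some feasible
   (a', b') above the current (a, b).  It survives each iteration because
   (a', b') can be modified, at no loss by concavity, to lie above the new
   (a, b).  An agent outside U is tight: no clean allocation gives it more
   goods without hurting another agent, so a'_i = a_i.  When no good is left,
   (a', b') = (a, b). *)

(** * Matroid closure *)

(** Local rank axioms: marginals are 0 or 1, so submodularity reduces to the persistence of zero
    marginals. *)
Definition matroid_rank (G : finType) (r : {set G} -> nat) : Prop :=
  [/\ r set0 = 0,
      forall S g, r S <= r (g |: S) <= (r S).+1
    & forall (S T : {set G}) g, S \subset T -> r (g |: S) = r S ->
        r (g |: T) = r T].

Lemma set_elim (G : finType) (P : {set G} -> Prop) :
  P set0 -> (forall x (A : {set G}), x \notin A -> P A -> P (x |: A)) ->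
    forall A, P A.
Proof.
move=> P0 PS A; have [k] := ubnP #|A|; elim: k A => // k IH A.
have [->//|[x xA]] := set_0Vmem A; rewrite -(setD1K xA) cardsU1 !inE eqxx add1n.
by rewrite ltnS => leA; apply: PS; rewrite ?inE ?eqxx //; apply: IH.
Qed.

Section Closure.
Variables (G : finType) (r : {set G} -> nat).
Hypothesis r_rank : matroid_rank r.
Implicit Types (S T A B I K : {set G}) (x z g : G).

Definition mclosure S : {set G} := [set z | r (z |: S) == r S].

Definition indep S : bool := r S == #|S|.

Lemma rank_step S g : r S <= r (g |: S) <= (r S).+1.
Proof. by case: r_rank. Qed.

Lemma in_closure S z : (z \in mclosure S) = (r (z |: S) == r S).
Proof. by rewrite inE. Qed.

Lemma sub_closure S z : z \in S -> z \in mclosure S.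
Proof. by move=> zS; rewrite in_closure (setUidPr _) // sub1set. Qed.

Lemma mclosureS S T z : S \subset T -> z \in mclosure S -> z \in mclosure T.
Proof.
by case: r_rank => _ _ rS sST; rewrite !in_closure => /eqP h; apply/eqP/(rS S).
Qed.

Lemma rank_setU A S : r S <= r (A :|: S) <= r S + #|A|.
Proof.
elim/set_elim: A => [|x A xA IH]; first by rewrite set0U cards0 addn0 leqnn.
rewrite -setUA cardsU1 xA.
by have := rank_step (A :|: S) x; lia.
Qed.

Lemma rankS S T : S \subset T -> r S <= r T.
Proof.
by move=> /setUidPl <-; case/andP: (rank_setU T S).
Qed.

Lemma rank_card S : r S <= #|S|.
Proof.
by have := rank_setU S set0; rewrite setU0; case: r_rank => -> _ _ /andP[].
Qed.

Lemma rank_closure A B : A \subset mclosure B -> r (A :|: B) = r B.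
Proof.
elim/set_elim: A => [|x A xA IH]; first by rewrite set0U.
rewrite subUset sub1set => /andP[xB AB]; rewrite -setUA -(IH AB).
by apply/eqP; rewrite -in_closure; apply: mclosureS xB; apply: subsetUr.
Qed.

Lemma closure_trans S z g :
  z \in mclosure S -> g \in mclosure (z |: S) -> g \in mclosure S.
Proof.
rewrite !in_closure => /eqP zS /eqP; rewrite zS => gS.
rewrite eqn_leq -{1}gS rankS ?setUS ?subsetUr //=.
by case/andP: (rank_step S g).
Qed.

(** Mac Lane-Steinitz exchange: [x] and [z] each raise the rank of [S] by one, and together they
    raise it by no more than one. *)
Lemma closure_exchange S x z :
  z \in mclosure (x |: S) -> z \notin mclosure S -> x \in mclosure (z |: S).
Proof.
rewrite !in_closure setUCA => /eqP xz zS; rewrite xz.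
have := rank_step S x; have := rank_step S z; have := rank_step (z |: S) x.
by rewrite xz; lia.
Qed.

Lemma indepS S T : S \subset T -> indep T -> indep S.
Proof.
move=> sST /eqP rT; rewrite /indep eqn_leq rank_card /=.
have -> : #|S| = #|T| - #|T :\: S|.
  by rewrite cardsD (setIidPr sST) subKn // subset_leq_card.
rewrite leq_subLR addnC -rT -{1}(setID T S) (setIidPr sST) setUC.
by case/andP: (rank_setU (T :\: S) S).
Qed.

Lemma indepU1 S x : indep S -> x \notin mclosure S -> indep (x |: S).
Proof.
move=> /eqP iS xS; have xNS : x \notin S by apply: contra xS => /sub_closure.
move: xS; rewrite /indep in_closure cardsU1 xNS -iS.
by have := rank_step S x; lia.
Qed.

Lemma indep_notin_closure I x : indep I -> x \in I ->
  x \notin mclosure (I :\ x).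
Proof.
move=> iI xI; rewrite in_closure setD1K //.
have /eqP -> := indepS (subsetDl I [set x]) iI.
by rewrite (eqP iI) (cardsD1 x I) xI; lia.
Qed.

(** The fundamental circuit of [z] in [I] avoids [x]. Otherwise exchange would put [x] in the span
    of [z] and [K :\ x], hence in that of [I :\ x], against independence. *)
Lemma closure_setD1 I K x z : indep I -> x \in I -> K \subset I ->
  z \in mclosure K -> z \in mclosure (I :\ x) -> z \in mclosure (K :\ x).
Proof.
move=> iI xI sKI zK zI; have [xK|xK] := boolP (x \in K); last first.
  by rewrite (setDidPl _) // disjoint_sym disjoints1.
apply/negPn/negP => zNK; move: zK; rewrite -(setD1K xK) => /closure_exchange.
move=> /(_ zNK) xz; case/negP: (indep_notin_closure iI xI).
by apply: (closure_trans zI); apply: mclosureS xz; rewrite setUS // setSD.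
Qed.

Lemma closure_setD I A z : indep I -> A \subset I -> z \in mclosure I ->
  (forall x, x \in A -> z \in mclosure (I :\ x)) -> z \in mclosure (I :\: A).
Proof.
move=> iI; elim/set_elim: A => [|x A xA IH]; first by rewrite setD0.
rewrite subUset sub1set => /andP[xI sAI] zI zA.
rewrite setUC -setDDl; apply: (closure_setD1 iI) => //; first exact: subsetDl.
- by apply: IH => // y yA; apply: zA; rewrite in_setU1 yA orbT.
- by apply: zA; rewrite in_setU1 eqxx.
Qed.

End Closure.

(** * Clean allocations and exchange paths *)

Section CleanAllocations.
Variables (n : nat) (G : finType) (r : option 'I_n -> {set G} -> nat).
Hypothesis r_rank : forall k, matroid_rank (r k).
Implicit Types (X Y Z : allocation n G) (o k : option 'I_n) (x z g : G).

Definition clean X : bool := [forall k, indep (r k) (bundle X k)].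

(** Span form of the exchange graph; it agrees with [exchange_edge] on clean allocations. *)
Definition swap_edge X : rel G :=
  fun x z => z \notin mclosure (r (X x)) (bundle X (X x) :\ x).

Definition addable X o : {set G} := ~: mclosure (r o) (bundle X o).

Definition reassign X g o : allocation n G :=
  [ffun x => if x == g then o else X x].

(** This is [augment] with an arbitrary first receiver [o], so that an induction along the path can
    pass to the former owner of its first good. *)
Definition shift_owners X o s : allocation n G :=
  [ffun g => if g \in s then nth None (o :: map X s) (index g s) else X g].

Lemma cleanP X : reflect (forall k, indep (r k) (bundle X k)) (clean X).
Proof. exact: forallP. Qed.

Lemma in_bundle X x k : (x \in bundle X k) = (X x == k).
Proof. by rewrite inE. Qed.

Lemma bundle_reassign X g o k :
  bundle (reassign X g o) k =
  if k == o then g |: bundle X k else bundle X k :\ g.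
Proof.
case: (k =P o) => [->|/eqP/negPf ko]; apply/setP=> x;
  rewrite ?eqxx ?ko !inE ffunE.
  by case: (x =P g) => //= _; rewrite eqxx.
by case: (x =P g) => //= _; rewrite eq_sym ko.
Qed.

Lemma in_addable X o g :
  (g \in addable X o) = (g \notin mclosure (r o) (bundle X o)).
Proof. by rewrite in_setC. Qed.

Lemma addable_notin X o g : g \in addable X o -> X g != o.
Proof.
by rewrite in_addable; apply: contra => /eqP gX; apply: sub_closure;
  rewrite in_bundle gX.
Qed.

Lemma clean_reassign X g o :
  clean X -> g \in addable X o -> clean (reassign X g o).
Proof.
move=> /cleanP iX gX; apply/cleanP => k; rewrite bundle_reassign.
case: eqP => [->|_]; last exact: (indepS (r_rank k) (subsetDl _ _)).
by apply: indepU1 => //; rewrite -in_addable.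
Qed.

(** Only the bundles of [o] and of the former owner of [g] change. In the first, if [g] helped to
    span [z], exchange would put [g] in the span of the old bundle of [o]. In the second, [z] is
    spanned without [g] and without [x], hence without both. *)
Lemma swap_edge_reassign X g o x z :
  clean X -> g \in addable X o -> x != g -> z \notin addable X o ->
  ~~ swap_edge X g z ->
  swap_edge (reassign X g o) x z = swap_edge X x z.
Proof.
move=> /cleanP iX gX xg; rewrite in_addable negbK => zX; rewrite negbK => gz.
rewrite /swap_edge ffunE (negPf xg) bundle_reassign; congr (~~ _).
have gNo := addable_notin gX; rewrite in_addable in gX.
have xX : x \in bundle X (X x) by rewrite in_bundle.
apply/idP/idP.
  case: eqP => [xo|_]; last first.
    by apply: (mclosureS (r_rank _)); rewrite setSD // subsetDl.
  rewrite xo in xX *; have -> : (g |: bundle X o) :\ x = g |: (bundle X o :\ x).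
    by rewrite setDUl; congr (_ :|: _);
      rewrite (setDidPl _) // disjoints1 inE eq_sym.
  move=> zg; apply/negPn/negP => zNx; case/negP: gX.
  apply: (closure_trans (r_rank o) zX).
  apply: (mclosureS (r_rank o)) (closure_exchange (r_rank o) zg zNx).
  by rewrite setUS // subsetDl.
case: eqP => [xo|_]; first by apply: (mclosureS (r_rank _));
  rewrite setSD // subsetUr.
have [xX'|xX'] := eqVneq (X x) (X g); last first.
  rewrite (_ : bundle X (X x) :\ g = bundle X (X x)) // (setDidPl _) //.
  by rewrite disjoint_sym disjoints1 in_bundle eq_sym.
rewrite xX' in xX * => zx; rewrite setDDl setUC -setDDl.
by apply: (closure_setD1 (r_rank _) (iX _)); rewrite ?in_bundle ?subsetDl.
Qed.

(** * Chordless and shortest exchange paths *)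

Fixpoint chordless (e : rel G) x q : bool :=
  if q is y :: q' then
    [&& x \notin q, e x y, all (fun z => ~~ e x z) q' & chordless e y q']
  else true.

Lemma eq_chordless (e e' : rel G) x q :
  {in x :: q & q, e =2 e'} -> chordless e x q = chordless e' x q.
Proof.
elim: q x => //= y q IH x ee'; rewrite ee' ?inE ?eqxx //.
rewrite (@IH y) => [|u w uq wq]; last by apply: ee'; rewrite inE ?uq ?wq orbT.
congr [&& _, _, _ & _]; apply: eq_in_all => z zq.
by rewrite ee' ?inE ?eqxx ?zq ?orbT.
Qed.

Lemma shift_cons X o g q : g \notin q ->
  shift_owners X o (g :: q) = shift_owners (reassign X g o) (X g) q.
Proof.
move=> gq; apply/ffunP => x; rewrite !ffunE in_cons /=.
case: (eqVneq x g) => [->|xg] /=; first by rewrite (negPf gq).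
case: ifP => // xq; congr (nth _ (_ :: _) _).
by apply/eq_in_map => z zq; rewrite ffunE; case: eqP gq => // <-; rewrite zq.
Qed.

Lemma card_bundle_reassign X g o k : X g != o ->
  #|bundle (reassign X g o) k| + (X g == k) = #|bundle X k| + (o == k).
Proof.
move=> gX; rewrite bundle_reassign (eq_sym o k); case: eqP => [->|/eqP ok].
  by rewrite cardsU1 in_bundle gX (negPf gX); lia.
by rewrite (cardsD1 g (bundle X k)) in_bundle; lia.
Qed.

(* The induction peels the path at its first good g: once g is given to o, the
   former owner of g plays the role of o for the rest of the path. *)
Lemma shift_chordless X o g q :
  clean X -> g \in addable X o -> {in q, forall z, z \notin addable X o} ->
  chordless (swap_edge X) g q ->
  clean (shift_owners X o (g :: q)) /\
  forall k, #|bundle (shift_owners X o (g :: q)) k| + (X (last g q) == k) =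
            #|bundle X k| + (o == k).
Proof.
elim: q X o g => [|h q IH] X o g cX gX qX.
  move=> _; rewrite shift_cons // /last; set X' := reassign X g o.
  have -> : shift_owners X' (X g) [::] = X' by apply/ffunP => x; rewrite ffunE.
  split; first exact: clean_reassign.
  by move=> k; rewrite card_bundle_reassign ?addable_notin.
rewrite [chordless _ _ _]/= => /and4P[ghq gh gq chq]; rewrite shift_cons //.
set X' := reassign X g o.
have gNo := addable_notin gX.
have bX' : bundle X' (X g) = bundle X (X g) :\ g.
  by rewrite bundle_reassign (negPf gNo).
have cX' : clean X' by apply: clean_reassign.
have qg z : z \in h :: q -> z != g by apply: contraTneq => ->.
(* The edge from [g] to [h] lets the former owner of [g] take [h]; the absence of chords from [g]
   means that it can take no later good. *)
case: (IH X' (X g) h cX').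
- by rewrite in_addable bX'.
- by move=> z zq; rewrite in_addable bX' negbK; have := allP gq z zq;
    rewrite negbK.
- rewrite (@eq_chordless _ (swap_edge X)) // => x z xq zq.
  apply: swap_edge_reassign => //; first exact: qg.
    by apply: qX; rewrite inE zq orbT.
  by have := allP gq z zq.
move=> cs sz; split=> // k; rewrite -(card_bundle_reassign k gNo) -/X' -(sz k).
by rewrite ffunE (negPf (qg _ (mem_last h q))).
Qed.

Lemma path_suffix (e : rel G) x q z : path e x q -> z \in q ->
  exists q', [/\ size q' < size q, path e z q' & last z q' = last x q].
Proof.
move=> pq /splitPr zq; case: q / zq pq => q1 q2.
rewrite cat_path last_cat /= => /and3P[_ _ pq2]; exists q2; split=> //.
by rewrite size_cat /=; lia.
Qed.

(** A repeated good or a chord could be cut out, leaving a shorter path with the same end. *)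
Lemma minimal_chordless (e : rel G) (B : pred G) x q :
  path e x q -> B (last x q) ->
  (forall q', path e x q' -> B (last x q') -> size q <= size q') ->
  chordless e x q.
Proof.
elim: q x => //= y q IH x /andP[exy pq] Bq min_q; apply/and4P; split=> //.
- have pyq : path e x (y :: q) by rewrite /= exy.
  apply/negP => /(path_suffix pyq)[q' [lt_q' pq' lq']].
  by have /= := min_q q' pq'; rewrite lq' => /(_ Bq); rewrite /= in lt_q'; lia.
- apply/allP => z zq; apply/negP => exz.
  have [q' [lt_q' pq' lq']] := path_suffix pq zq.
  by have /= := min_q (z :: q'); rewrite exz pq' lq' => /(_ isT Bq); lia.
- apply: IH => // q' pq' Bq'.
  by have /= := min_q (y :: q'); rewrite exy; apply.
Qed.

(** A later addable good would start a shorter path. The target [B] is a single good in the exchange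
    argument and the set of unallocated goods in the algorithm. *)
Lemma shift_shortest X o (B : pred G) g q :
  clean X -> g \in addable X o -> path (swap_edge X) g q -> B (last g q) ->
  (forall g' q', g' \in addable X o -> path (swap_edge X) g' q' ->
     B (last g' q') -> size q <= size q') ->
  clean (shift_owners X o (g :: q)) /\
  forall k, #|bundle (shift_owners X o (g :: q)) k| + (X (last g q) == k) =
            #|bundle X k| + (o == k).
Proof.
move=> cX gX pq Bq min_q; apply: shift_chordless => //.
  move=> z zq; apply/negP => zX; have [q' [lt_q' pq' lq']] := path_suffix pq zq.
  by have := min_q z q' zX pq'; rewrite lq' => /(_ Bq); lia.
by apply: (@minimal_chordless _ B) => // q' ; apply: min_q.
Qed.

Lemma ex_shortest (P : G -> seq G -> bool) g q : P g q ->
  exists g' q', P g' q' /\ forall g'' q'', P g'' q'' -> size q' <= size q''.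
Proof.
(* Tuples of fixed length form a finite type, so the existence of a path of length [m] is decidable
   and a least [m] can be found. *)
move=> Pgq; pose Q (m : nat) := [exists x, [exists t : m.-tuple G, P x t]].
have QP x s : P x s -> Q (size s).
  by move=> Pxs; apply/existsP; exists x; apply/existsP; exists (in_tuple s).
have exQ : exists m, Q m by exists (size q); apply: (QP g).
have [m /existsP[x /existsP[t Pxt]] min_m] := ex_minnP exQ.
by exists x, t; split=> // y s /QP/min_m; rewrite size_tuple.
Qed.

(** * Reachable goods and the exchange property of clean allocations *)

Definition reachable X o : {set G} :=
  [set x | [exists g in addable X o, connect (swap_edge X) g x]].

Lemma reachableP X o x :
  reflect (exists g q, [/\ g \in addable X o, path (swap_edge X) g q
                         & last g q = x])
          (x \in reachable X o).
Proof.
rewrite inE; apply: (iffP exists_inP) => [[g gX /connectP[q pq ->]]|].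
  by exists g, q.
by case=> g [q [gX pq <-]]; exists g => //; apply/connectP; exists q.
Qed.

Lemma reachable_shift X o x : clean X -> x \in reachable X o ->
  exists2 Y, clean Y &
    forall k, #|bundle Y k| + (X x == k) = #|bundle X k| + (o == k).
Proof.
move=> cX /reachableP[g [q [gX pq lq]]].
pose P g q := [&& g \in addable X o, path (swap_edge X) g q & last g q == x].
have /ex_shortest[g' [q' [/and3P[gX' pq' lq'] min_q']]] : P g q.
  by rewrite /P gX pq lq eqxx.
have [g'' q'' gX'' pq'' lq''|cY sY] := shift_shortest (B := pred1 x) cX gX' pq'
  lq'.
  by apply: (min_q' g''); rewrite /P gX'' pq''.
by exists (shift_owners X o (g' :: q')) => // k; rewrite -sY (eqP lq').
Qed.

Lemma card_bundleI X (A : {set G}) :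
  \sum_k #|bundle X k :&: A| = #|A|.
Proof.
rewrite -[RHS]sum1_card (partition_big (fun g => X g) predT) //=.
apply: eq_bigr => k _; rewrite -sum1_card; apply: eq_bigl => g.
by rewrite !inE andbC.
Qed.

(* The goods of T = ~: reachable Y o lie in the span of those of Y_k for every
   k that is o or owns a reachable good, so no clean allocation gives these
   agents more goods in total than Y. *)
Lemma exchange Y Z o : clean Y -> clean Z -> #|bundle Y o| < #|bundle Z o| ->
  exists2 x, x \in reachable Y o & #|bundle Z (Y x)| < #|bundle Y (Y x)|.
Proof.
move=> cY cZ ltYZ; set S := reachable Y o.
have [//|noS] := boolP [exists x in S, #|bundle Z (Y x)| < #|bundle Y (Y x)|].
  by move=> /exists_inP.
pose J := [set k | (k == o) || (bundle Y k :&: S != set0)].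
have spanT k z : k \in J -> z \notin S ->
  z \in mclosure (r k) (bundle Y k :\: S).
  rewrite inE => kJ zS.
  have zY x : x \in bundle Y k :&: S -> z \in mclosure (r k) (bundle Y k :\ x).
    rewrite in_setI in_bundle => /andP[/eqP kx xS].
    apply/negPn; rewrite -kx; apply: contra zS => xz.
    have [g [q [gY pq lq]]] := reachableP _ _ _ xS.
    apply/reachableP; exists g, (rcons q z); split; rewrite ?last_rcons //.
    by rewrite rcons_path pq lq.
  have -> : bundle Y k :\: S = bundle Y k :\: (bundle Y k :&: S).
    by rewrite setDIr setDv set0U.
  apply: closure_setD => //; first exact: (cleanP _ cY).
    exact: subsetIl.
  case/orP: kJ => [/eqP->|/set0Pn[x xYS]].
    apply/negPn; rewrite -in_addable; apply: contra zS => zY'.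
    by apply/reachableP; exists z, [::].
  by apply: (mclosureS (r_rank k)) (zY x xYS); apply: subsetDl.
have leJ k : k \in J -> #|bundle Z k :\: S| <= #|bundle Y k :\: S|.
  move=> kJ.
  have /eqP <- := indepS (r_rank k) (subsetDl (bundle Z k) S) (cleanP _ cZ k).
  apply: leq_trans (rank_card (r_rank k) _).
  rewrite -[leqRHS](rank_closure (r_rank k) (A := bundle Z k :\: S)).
    by apply: (rankS (r_rank k)); apply: subsetUl.
  by apply/subsetP => z; rewrite in_setD => /andP[zS _]; apply: spanT.
(* Under [Y] all goods of [S] are owned within [J]; under [Z] some may lie outside. *)
have SJ : \sum_(k in J) #|bundle Z k :&: S| <= \sum_(k in J) #|bundle Y k :&:
  S|.
  have -> : \sum_(k in J) #|bundle Y k :&: S| = #|S|.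
    rewrite -(card_bundleI Y S) [RHS](bigID (mem J)) /=.
    rewrite [X in _ = _ + X]big1 ?addn0 // => k; rewrite inE negb_or negbK.
    by case/andP=> _ /eqP->; rewrite cards0.
  by rewrite -(card_bundleI Z S) [leqRHS](bigID (mem J)) leq_addr.
have : \sum_(k in J) #|bundle Z k| <= \sum_(k in J) #|bundle Y k|.
  rewrite [leqLHS](eq_bigr _ (fun k _ => esym (cardsID S (bundle Z k)))).
  rewrite [leqRHS](eq_bigr _ (fun k _ => esym (cardsID S (bundle Y k)))).
  by rewrite !big_split leq_add // leq_sum.
(* Yet [Z] gives strictly more to [o] and, by [noS], no less to the rest of [J]. *)
rewrite leqNgt => /negP[]; rewrite (bigD1 o) ?inE ?eqxx //=.
rewrite [ltnRHS](bigD1 o) ?inE ?eqxx //= -addSn leq_add //.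
apply: leq_sum => k /andP[]; rewrite inE => /orP[->//|].
case/set0Pn=> x; rewrite in_setI in_bundle => /andP[/eqP <- xS] _.
by move: noS; rewrite negb_exists_in => /forall_inP/(_ x xS); rewrite -leqNgt.
Qed.

End CleanAllocations.

(** * Welfare domination *)

Section Domination.
Variables (R : realDomainType) (n : nat) (G : finType) (c : nat).
Variables (r : option 'I_n -> {set G} -> nat) (W : nat -> R).
Hypothesis r_rank : forall k, matroid_rank (r k).
Hypothesis r_None : forall S, r None S = #|S|.
Hypothesis c_gt0 : 0 < c.
Hypothesis W_mono : forall x, (W x <= W x.+1)%R.
Hypothesis W_concave : forall x, (W x.+2 - W x.+1 <= W x.+1 - W x)%R.
Implicit Types (X Y Z : allocation n G) (i j k : 'I_n) (b : 'I_n -> nat).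

Lemma W_homo x y : x <= y -> (W x <= W y)%R.
Proof.
move=> /subnK <-; elim: (y - x) => //= d IH.
by apply: le_trans IH _; apply: W_mono.
Qed.

Lemma W_gain d x y : x <= y -> (W (y + d) - W y <= W (x + d) - W x)%R.
Proof.
have step : forall y x, x <= y -> (W y.+1 - W y <= W x.+1 - W x)%R.
  move=> {}y {}x /subnK <-; elim: (y - x) => //= m IH.
  by apply: le_trans IH; apply: W_concave.
move=> xy; elim: d => [|d IH]; first by rewrite !addn0 !subrr.
by have := step (y + d) (x + d); rewrite leq_add2r !addnS => /(_ xy); lra.
Qed.

Definition tight X i : Prop :=
  forall Z, clean r Z ->
    (forall j, #|bundle X (Some j)| <= #|bundle Z (Some j)|) ->
    #|bundle Z (Some i)| = #|bundle X (Some i)|.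

(** Here [b'] only counts goods of value 1, bounded in total by what [Y] leaves unallocated; which
    goods they are does not affect the welfare. *)
Definition dominated X b (t : R) : Prop :=
  exists Y b',
    [/\ clean r Y,
        forall j, #|bundle X (Some j)| <= #|bundle Y (Some j)|,
        forall j, b j <= b' j,
        \sum_j b' j <= #|bundle Y None|
      & (t <= \sum_j W (c * #|bundle Y (Some j)| + b' j))%R].

Lemma sum_two (V : nmodType) (f : 'I_n -> V) i j : j != i ->
  (\sum_k f k = f i + (f j + \sum_(k | (k != i) && (k != j)) f k))%R.
Proof. by move=> ji; rewrite (bigD1 i) //= (bigD1 j). Qed.

Lemma le_sum_two (f g : 'I_n -> R) i j : j != i ->
  (forall k, k != i -> k != j -> f k = g k) ->
  (f i + f j <= g i + g j)%R -> (\sum_k f k <= \sum_k g k)%R.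
Proof.
move=> ji fg le_fg; rewrite !(@sum_two _ _ i j) // !addrA lerD //.
by rewrite (eq_bigr g) // => k /andP[ki kj]; apply: fg.
Qed.

Lemma eq_sum_two (f g : 'I_n -> nat) i j : j != i ->
  (forall k, k != i -> k != j -> f k = g k) ->
  f i + f j = g i + g j -> \sum_k f k = \sum_k g k.
Proof.
move=> ji fg efg; rewrite [LHS](bigD1 i) // [RHS](bigD1 i) //=.
rewrite (bigD1 j) // [in RHS](bigD1 j) //= !addnA efg; congr (_ + _).
by apply: eq_bigr => k /andP[ki kj]; apply: fg.
Qed.

Lemma le_sum_one (f g : 'I_n -> R) i : (forall k, k != i -> f k = g k) ->
  (f i <= g i)%R -> (\sum_k f k <= \sum_k g k)%R.
Proof.
move=> fg le_fg; rewrite [leLHS](bigD1 i) // [leRHS](bigD1 i) //= lerD //.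
by rewrite (eq_bigr g).
Qed.

Lemma sum_incr (f g : 'I_n -> nat) i : (forall k, k != i -> f k = g k) ->
  g i = (f i).+1 -> \sum_k g k = (\sum_k f k).+1.
Proof.
move=> fg gi; rewrite (bigD1 i) //= gi [X in _ = X.+1](bigD1 i) //= addSn.
by congr (_ + _).+1; apply: eq_bigr => k /fg.
Qed.

Lemma leq_sum_eq (f g : 'I_n -> nat) : (forall k, f k <= g k) ->
  \sum_k g k <= \sum_k f k -> forall k, f k = g k.
Proof.
move=> fg; have := leqif_sum (fun k (_ : true) => leqif_eq (fg k)).
move=> [le_s eq_s] ge_s k; apply/eqP.
by move: eq_s; rewrite eqn_leq le_s ge_s => /esym/forallP/(_ k).
Qed.

Lemma card_bundles X :
  #|bundle X None| + \sum_j #|bundle X (Some j)| = #|G|.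
Proof.
rewrite -cardsT -(card_bundleI X [set: G]) (bigD1 None) //= setIT;
  congr (_ + _).
rewrite (reindex_omap Some id) /=; last by case.
by apply: eq_big => [j|j _]; rewrite ?setIT ?eqxx.
Qed.

Lemma clean_discard X g : clean r X -> X g != None ->
  clean r (reassign X g None).
Proof.
move=> cX gX; apply: clean_reassign => //; rewrite in_addable in_closure //.
by rewrite !r_None cardsU1 in_bundle gX; lia.
Qed.

(** If [Y] gives [i] no more than [X], the exchange property supplies one more good for [i], at the
    expense of an agent [j], necessarily in [U] by tightness, or of the unallocated goods. In the
    latter case a good of value 1 may have to be given up, by [i] if it has one, else by some [j]
    with [b j < b' j]; the gain comparisons cover the loss. *)
Lemma dominated_augment X X' b t (U : {set 'I_n}) i :
  clean r X' ->
  (forall k : option 'I_n,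
     #|bundle X' k| + (None == k) = #|bundle X k| + (Some i == k)) ->
  i \in U -> (forall k, k \in U -> b k = 0) ->
  (forall k, k \notin U -> tight X k) ->
  \sum_j b j < #|bundle X None| ->
  (forall k, k \in U -> #|bundle X (Some i)| <= #|bundle X (Some k)|) ->
  (forall k, k \notin U ->
     W (c * #|bundle X (Some k)| + b k).+1 - W (c * #|bundle X (Some k)| + b k)
     <= W (c * #|bundle X (Some i)| + c) - W (c * #|bundle X (Some i)|))%R ->
  dominated X b t -> dominated X' b t.
Proof.
move=> cX' sX' iU bU tX sb gU gN [Y [b' [cY XY bb' sb' leW]]].
have [ltXY|] := ltnP #|bundle X (Some i)| #|bundle Y (Some i)|.
  exists Y, b'; split=> // j; have := sX' (Some j); have := XY j.
  by rewrite (inj_eq Some_inj) /=; have [<-|_] := eqVneq i j; lia.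
move=> leYX; have eYX : #|bundle Y (Some i)| = #|bundle X (Some i)|.
  by apply/eqP; rewrite eqn_leq leYX XY.
have [|x xY] := exchange r_rank cY cX' (o := Some i).
  by have := sX' (Some i); rewrite eYX eqxx /=; lia.
have [Y' cY'] := reachable_shift r_rank cY xY.
have bi : b i = 0 by apply: bU.
case: (Y x) => [j|] sY' lt_j.
- have ij : j != i by apply: contraTneq lt_j => ->; have := sX' (Some i);
    rewrite eqxx /=; lia.
  have sX'j : #|bundle X' (Some j)| = #|bundle X (Some j)|.
    by have := sX' (Some j);
      rewrite (inj_eq Some_inj) [i == j]eq_sym (negPf ij) /=; lia.
  have jU : j \in U.
    by apply/negPn/negP => jU; have := tX j jU Y cY XY; lia.
  (* In exchange for a good of value c, agent i hands e goods of value 1 over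
     to j; by concavity the net transfer of c - e does not hurt. *)
  pose e := minn (b' i) c.
  pose b'' k := if k == i then b' i - e else if k == j then b' j + e else b' k.
  have sY'i : #|bundle Y' (Some i)| = #|bundle X (Some i)|.+1.
    by have := sY' (Some i); rewrite (inj_eq Some_inj) (negPf ij) eqxx eYX /=;
      lia.
  have sY'j : #|bundle Y (Some j)| = #|bundle Y' (Some j)|.+1.
    by have := sY' (Some j);
      rewrite !(inj_eq Some_inj) [i == j]eq_sym (negPf ij) eqxx /=; lia.
  have sY'k k : k != i -> k != j ->
    #|bundle Y' (Some k)| = #|bundle Y (Some k)|.
    move=> ki kj; have := sY' (Some k).
    by rewrite !(inj_eq Some_inj) ![_ == k]eq_sym (negPf ki) (negPf kj) !addn0.
  exists Y', b''; split=> //.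
  + move=> k; have := XY k; have := sX' (Some k); rewrite /= (inj_eq Some_inj).
    have [->|ki] := eqVneq k i; first by rewrite sY'i; clear; lia.
    have [->|kj] := eqVneq k j; first by move: lt_j sY'j; clear; lia.
    by rewrite sY'k //; clear; lia.
  + move=> k; have := bb' k; rewrite /b''; case: eqP => [->|_];
      first by rewrite bi.
    by case: eqP => [->|_] //; clear; lia.
  + have := sY' None; rewrite /= !addn0 => ->; apply: leq_trans sb'.
    rewrite (@eq_sum_two b'' b' i j) // /b'' => [k|];
      first by move=> /negPf-> /negPf->.
    by rewrite !eqxx (negPf ij) /e; lia.
  + apply: le_trans leW _; apply: (@le_sum_two _ _ i j) => // [k ki kj|].
      by rewrite /b'' (negPf ki) (negPf kj) sY'k.
    rewrite /b'' !eqxx (negPf ij) sY'i sY'j eYX.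
    have le_ij : #|bundle X (Some i)| <= #|bundle Y' (Some j)|.
      by have := gU j jU; lia.
    set y := #|bundle Y' _|; set z := #|bundle X _| in le_ij *.
    (* If [e = c], both utilities are unchanged. If [e = b' i], agent [j] still ends at or above the
       old utility of [i], so concavity applies. *)
    have [e_c|e_b] : e = c \/ e = b' i by rewrite /e; lia.
      have -> : c * z.+1 + (b' i - e) = c * z + b' i.
        by rewrite /e in e_c *; lia.
      have -> : c * y + (b' j + e) = c * y.+1 + b' j by rewrite e_c; lia.
      by [].
    have le_zy : c * z <= c * y by rewrite leq_mul2l le_ij orbT.
    have := @W_gain (c - e) (c * z + b' i) (c * y + (b' j + e)).
    rewrite -{1}e_b (leq_trans (leq_add le_zy (leqnn e))); last by lia.
    have -> : c * y + (b' j + e) + (c - e) = c * y.+1 + b' j by rewrite /e; lia.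
    have -> : c * z + b' i + (c - e) = c * z.+1 + (b' i - e).
      by rewrite /e in e_b *; lia.
    by move=> /(_ isT); lra.
- have sY'i : #|bundle Y' (Some i)| = #|bundle X (Some i)|.+1.
    by have := sY' (Some i); rewrite eqxx eYX /=; lia.
  have sY'k k : k != i -> #|bundle Y' (Some k)| = #|bundle Y (Some k)|.
    move=> ki; have := sY' (Some k).
    by rewrite !(inj_eq Some_inj) ![_ == k]eq_sym (negPf ki) !addn0.
  have X'Y' k : #|bundle X' (Some k)| <= #|bundle Y' (Some k)|.
    have := XY k; have := sX' (Some k); rewrite /= (inj_eq Some_inj).
    have [->|ki] := eqVneq k i; first by rewrite sY'i; clear; lia.
    by rewrite sY'k //; clear; lia.
  have sYN := sY' None; have sXN := sX' None; rewrite eqxx /= in sYN sXN.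
  (* Agent [j] gives up one good of value 1 to make room for the good that [i] takes from the
     unallocated ones. *)
  have drop j : b j < b' j ->
      (W (c * #|bundle Y (Some j)| + b' j) - W (c * #|bundle Y (Some j)| + (b'
        j).-1)
       <= W (c * #|bundle X (Some i)| + c) - W (c * #|bundle X (Some i)|))%R ->
      j != i -> b' i = 0 -> dominated X' b t.
    move=> ltj gj ji b'i; pose b'' k := if k == j then (b' j).-1 else b' k.
    exists Y', b''; split=> //.
    + by move=> k; rewrite /b''; case: eqP => [->|_]; [lia|apply: bb'].
    + have : \sum_k b' k = (\sum_k b'' k).+1; last by lia.
      by apply: (@sum_incr b'' b' j) => [k /negPf kj|];
        rewrite /b'' ?kj ?eqxx //; lia.
    + apply: le_trans leW _; apply: (@le_sum_two _ _ i j) => // [k ki kj|].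
        by rewrite /b'' (negPf kj) sY'k.
      rewrite /b'' eqxx [i == j]eq_sym (negPf ji) b'i sY'i sY'k // eYX !addn0.
      by rewrite mulnS [c + _]addnC; move: gj; lra.
  have [b'i|b'i] := posnP (b' i); last first.
    pose b'' k := if k == i then (b' i).-1 else b' k.
    exists Y', b''; split=> //.
    + by move=> k; rewrite /b''; case: eqP => [->|_]; [lia|apply: bb'].
    + have : \sum_k b' k = (\sum_k b'' k).+1; last by lia.
      by apply: (@sum_incr b'' b' i) => [k /negPf kj|];
        rewrite /b'' ?kj ?eqxx //; lia.
    + apply: le_trans leW _; apply: (@le_sum_one _ _ i) => [k ki|].
        by rewrite /b'' (negPf ki) sY'k.
      by rewrite /b'' eqxx sY'i eYX; apply: W_homo; lia.
  have [sb'Y|sb'Y] := ltnP (\sum_j b' j) #|bundle Y None|.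
    exists Y', b'; split=> //; first by lia.
    apply: le_trans leW _; apply: (@le_sum_one _ _ i) => [k ki|];
      first by rewrite sY'k.
    by rewrite sY'i eYX; apply: W_homo; lia.
  have [/existsP[j ltj]|/existsPn noj] := boolP [exists j, b j < b' j];
    last first.
    have : \sum_j b' j <= \sum_j b j.
      by apply: leq_sum => j _; have := noj j; lia.
    by lia.
  have ji : j != i by apply: contraTneq ltj => ->; rewrite b'i.
  apply: (drop j) => //; have [jU|jU] := boolP (j \in U).
    apply: (@le_trans _ _ (W (c * #|bundle X (Some i)| + 1) - W (c * #|bundle X
      (Some i)|))%R).
      have := @W_gain 1 (c * #|bundle X (Some i)|) (c * #|bundle Y (Some j)| +
        (b' j).-1).
      rewrite -addnA addn1 prednK; last by lia.
      apply; apply: leq_trans (leq_addr _ _); rewrite leq_mul2l.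
      by rewrite (leq_trans (gU j jU) (XY j)) orbT.
    by rewrite lerB // W_homo //; lia.
  (* By tightness [Y] and [X] agree at [j], so the unit lost by [j] lies at or above its current
     utility. *)
  apply: le_trans (gN j jU); rewrite (tX j jU Y cY XY).
  have := @W_gain 1 (c * #|bundle X (Some j)| + b j) (c * #|bundle X (Some j)|
    + (b' j).-1).
  rewrite -addnA addn1 prednK; last by lia.
  by rewrite addn1 leq_add2l; apply; lia.
Qed.

(** If [b' i = b i], one more good of value 1 for [i] comes from a good left over by [Y] and [b'],
    from some [j] with [b j < b' j], or from a good of value [c] that [Y] gives to some [j] in [U]
    beyond [X]. *)
Lemma dominated_extra X b t (U : {set 'I_n}) i :
  i \notin U -> (forall k, k \in U -> b k = 0) ->
  (forall k, k \notin U -> tight X k) ->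
  \sum_j b j < #|bundle X None| ->
  let u k := c * #|bundle X (Some k)| + b k in
  (forall k, k \notin U -> W (u k).+1 - W (u k) <= W (u i).+1 - W (u i))%R ->
  (forall k, k \in U -> W (u k + c) - W (u k) <= W (u i).+1 - W (u i))%R ->
  dominated X b t -> dominated X (fun k => b k + (k == i)) t.
Proof.
move=> iU bU tX sb u gN gU [Y [b' [cY XY bb' sb' leW]]].
have [ltb|leb] := ltnP (b i) (b' i).
  exists Y, b'; split=> // k; have := bb' k.
  by have [->|_] := eqVneq k i; rewrite ?eqxx /=; lia.
have b'i : b' i = b i by have := bb' i; lia.
have sYi := tX i iU Y cY XY.
have bb'' (b'' : 'I_n -> nat) : b'' i = (b' i).+1 ->
    (forall k, k != i -> b k <= b'' k) -> forall k, b k + (k == i) <= b'' k.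
  move=> b''i b''k k; have [->|ki] := eqVneq k i;
    first by rewrite b''i b'i addn1.
  by rewrite addn0 b''k.
have [sb'Y|sb'Y] := ltnP (\sum_j b' j) #|bundle Y None|.
  pose b'' k := if k == i then (b' i).+1 else b' k.
  exists Y, b''; split=> //.
  - by apply: bb''; rewrite /b'' ?eqxx // => k /negPf->.
  - rewrite (@sum_incr b' b'' i) // /b'' ?eqxx // => k /negPf-> //.
  - apply: le_trans leW _; apply: (@le_sum_one _ _ i) => [k /negPf ki|].
      by rewrite /b'' ki.
    by rewrite /b'' eqxx; apply: W_homo; lia.
have [/existsP[j ltj]|/existsPn noj] := boolP [exists j, b j < b' j].
  have ji : j != i by apply: contraTneq ltj => ->; rewrite b'i ltnn.
  pose b'' k := if k == i then (b' i).+1 else if k == j then (b' j).-1 else b'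
    k.
  exists Y, b''; split=> //.
  - apply: bb''; rewrite /b'' ?eqxx // => k /negPf->.
    by case: eqP => [->|_]; [lia|apply: bb'].
  - rewrite (@eq_sum_two b'' b' i j) // /b'' => [k /negPf-> /negPf-> //|].
    by rewrite !eqxx (negPf ji); lia.
  - apply: le_trans leW _;
      apply: (@le_sum_two _ _ i j) => // [k /negPf ki /negPf kj|].
      by rewrite /b'' ki kj.
    rewrite /b'' !eqxx (negPf ji) sYi b'i addnS -/(u i).
    suff : (W (c * #|bundle Y (Some j)| + b' j) -
            W (c * #|bundle Y (Some j)| + (b' j).-1) <= W (u i).+1 - W (u i))%R
              by lra.
    have : (W (c * #|bundle Y (Some j)| + b' j) -
        W (c * #|bundle Y (Some j)| + (b' j).-1) <= W (u j).+1 - W (u j))%R.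
      have := @W_gain 1 (u j) (c * #|bundle Y (Some j)| + (b' j).-1).
      rewrite -addnA addn1 prednK; last by lia.
      rewrite addn1; apply; rewrite /u leq_add //; last by lia.
      by rewrite leq_mul2l XY orbT.
    move=> /le_trans; apply; have [jU|jU] := boolP (j \in U); last exact: gN.
    by apply: le_trans (gU j jU); rewrite lerB // W_homo //; lia.
(* Now [Y] leaves fewer goods unallocated than [X], so it hands out more. *)
have [j ltj] : exists j, #|bundle X (Some j)| < #|bundle Y (Some j)|.
  apply/existsP; rewrite -[[exists _, _]]negbK; apply/negP => /existsPn noj'.
  have : \sum_j b' j <= \sum_j b j by apply: leq_sum => j _; have := noj j; lia.
  have : \sum_j #|bundle Y (Some j)| <= \sum_j #|bundle X (Some j)|.
    by apply: leq_sum => j _; rewrite leqNgt; apply: noj'.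
  by have := card_bundles X; have := card_bundles Y; lia.
have jU : j \in U.
  by apply: contraTT ltj => jU; rewrite (tX j jU Y cY XY) ltnn.
have ji : j != i by apply: contraNneq iU => <-.
(* Discarding one good of [j] frees it to count as a good of value 1 for [i]. *)
have /card_gt0P[g] : 0 < #|bundle Y (Some j)| by lia.
rewrite in_bundle => /eqP gj; pose Y' := reassign Y g None.
have sY' (k : option 'I_n) : #|bundle Y' k| + (Some j == k) =
  #|bundle Y k| + (None == k).
  by rewrite -gj; apply: card_bundle_reassign; rewrite gj.
pose b'' k := if k == i then (b' i).+1 else b' k.
have sY'j : #|bundle Y (Some j)| = #|bundle Y' (Some j)|.+1.
  by have := sY' (Some j); rewrite eqxx /=; lia.
have sY'k k : k != j -> #|bundle Y' (Some k)| = #|bundle Y (Some k)|.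
  move=> kj; have := sY' (Some k).
  by rewrite (inj_eq Some_inj) [j == k]eq_sym (negPf kj) /=; lia.
exists Y', b''; split=> //.
- by apply: clean_discard; rewrite ?gj.
- move=> k; have [->|kj] := eqVneq k j; first by lia.
  by rewrite sY'k.
- by apply: bb''; rewrite /b'' ?eqxx // => k /negPf->.
- rewrite (@sum_incr b' b'' i) // /b'' ?eqxx // => [|k /negPf-> //].
  by have := sY' None; rewrite eqxx /= addn0 addn1 => ->; rewrite ltnS.
- apply: le_trans leW _; apply: (@le_sum_two _ _ i j) => // [k /negPf ki kj|].
    by rewrite /b'' ki sY'k.
  rewrite /b'' !eqxx (negPf ji) (sY'k i) 1?eq_sym // sYi b'i addnS -/(u i) sY'j.
  have := gU j jU; have := @W_gain c (u j) (c * #|bundle Y' (Some j)| + b' j).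
  have -> : c * #|bundle Y' (Some j)| + b' j + c =
    c * #|bundle Y' (Some j)|.+1 + b' j.
    by lia.
  rewrite {1}/u (bU j jU) addn0.
  have -> : c * #|bundle X (Some j)| <= c * #|bundle Y' (Some j)| + b' j.
    by apply: leq_trans (leq_addr _ _); rewrite leq_mul2l; apply/orP; right;
      lia.
  by move=> /(_ isT); lra.
Qed.

(** Once [b] uses up the unallocated goods, counting all goods turns the inequalities between the
    two pairs into equalities. *)
Lemma dominated_le X b t : #|bundle X None| <= \sum_j b j ->
  dominated X b t -> (t <= \sum_j W (c * #|bundle X (Some j)| + b j))%R.
Proof.
move=> sb [Y [b' [cY XY bb' sb' leW]]].
have sXY : \sum_j #|bundle X (Some j)| <= \sum_j #|bundle Y (Some j)|.
  by apply: leq_sum.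
have sbb' : \sum_j b j <= \sum_j b' j by apply: leq_sum.
have cX := card_bundles X; have cY' := card_bundles Y.
have sYX : \sum_j #|bundle Y (Some j)| <= \sum_j #|bundle X (Some j)| by lia.
have sb'b : \sum_j b' j <= \sum_j b j by lia.
have eqX := leq_sum_eq XY sYX; have eqb := leq_sum_eq bb' sb'b.
apply: le_trans leW _; rewrite le_eqVlt; apply/orP; left; apply/eqP.
by apply: eq_bigr => j _; rewrite eqX eqb.
Qed.

End Domination.

(** * Bivalued submodular valuations *)

Section BivaluedSubmodular.
Variables (R : realType) (G : finType) (c : nat) (v : {set G} -> R).
Hypothesis c_gt1 : 1 < c.
Hypothesis v_SUB : oneC_SUB c v.
Implicit Types (S T A : {set G}) (g x : G).

Lemma natr_inj (m1 m2 : nat) : (m1%:R = m2%:R :> R)%R -> m1 = m2.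
Proof. by move/eqP; rewrite eqr_nat => /eqP. Qed.

Lemma SUB_setU1 A x : x \notin A ->
  v (x |: A) = (v A + 1)%R \/ v (x |: A) = (v A + c%:R)%R.
Proof.
case: v_SUB => _ _ v1c _ xA; rewrite /marginal in v1c.
by case: (v1c A x xA) => <-; [left|right]; rewrite addrC subrK.
Qed.

Lemma SUB_ge T A : A \subset ~: T -> (v T + #|A|%:R <= v (A :|: T))%R.
Proof.
elim/set_elim: A => [|x A xA IH]; first by rewrite cards0 addr0 set0U.
rewrite subUset sub1set in_setC => /andP[xT /IH le_vT].
rewrite cardsU1 xA -setUA add1n -natr1.
have xAT : x \notin A :|: T by rewrite inE negb_or xA.
have c_ge1 : (1 <= c%:R :> R)%R by rewrite ler1n ltnW.
by case: (SUB_setU1 xAT) => ->; lra.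
Qed.

(** Insert the goods one by one and collect in [T] those of marginal [c]; by diminishing marginals
    each has marginal [c] over the smaller set [T] as well. *)
Lemma SUB_witness S : exists2 T : {set G}, T \subset S &
  v T = (c * #|T|)%:R%R /\ v S = (#|S| + c.-1 * #|T|)%:R%R.
Proof.
case: (v_SUB) => _ v0 _ v_sub; elim/set_elim: S => [|x A xA [T sTA [vT vA]]].
  by exists set0; rewrite ?sub0set // v0 cards0 !muln0.
have xT : x \notin T by apply: contra xA; apply: (subsetP sTA).
have := v_sub T A x sTA xA; rewrite /marginal.
have [vAx|vAx] := SUB_setU1 xA.
  exists T; first by apply: subset_trans sTA (subsetUr _ _).
  by rewrite vAx vA cardsU1 xA natr1; split=> //; congr (_%:R)%R; lia.
have [vTx|vTx] := SUB_setU1 xT.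
  rewrite vAx vTx ![(_ + _ - _)%R]addrAC !subrr !add0r => c_le1.
  by move: c_gt1; rewrite -(ltr1n R) ltNge c_le1.
exists (x |: T); first exact: setUS.
by rewrite vAx vTx vA vT !cardsU1 xA xT -!natrD; split; congr (_%:R)%R; lia.
Qed.

End BivaluedSubmodular.

(** * The functions [beta] as matroid ranks, and the exchange graph in terms of spans *)

Section ValuationRank.
Variables (R : realType) (n : nat) (G : finType) (c : nat).
Variable v : 'I_n -> {set G} -> R.
Hypothesis c_gt1 : 1 < c.
Hypothesis v_SUB : forall i, oneC_SUB c (v i).
Implicit Types (S T : {set G}) (g x : G) (k : option 'I_n) (X Y : allocation n
  G).
Local Notation r := (beta c v).

Lemma beta_None S : r None S = #|S|.
Proof.
apply/eqP; rewrite eqn_leq; apply/andP; split.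
  by apply/bigmax_leqP => T /andP[/subset_leq_card].
by apply: (@leq_bigmax_cond _ _ (fun T : {set G} => #|T|)); rewrite subxx /=.
Qed.

(** The witness set is a largest one: over any competitor the remaining goods add at least 1 each,
    so the value of [S] bounds the size of the competitor. *)
Lemma valuation_beta i S : v i S = (#|S| + c.-1 * r (Some i) S)%:R%R.
Proof.
have [T sTS [vT vS]] := SUB_witness c_gt1 (v_SUB i) S; rewrite vS.
congr (_ + _ * _)%:R%R; apply/esym/eqP; rewrite eqn_leq; apply/andP; split.
  apply/bigmax_leqP => T' /andP[sT'S /eqP /= vT'].
  have := SUB_ge c_gt1 (v_SUB i) (T := T') (A := S :\: T').
  have -> : S :\: T' :|: T' = S by rewrite setUC -{1}(setIidPr sT'S) setID.
  rewrite setDE subsetIr => /(_ isT);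
    rewrite vT' vS -setDE -natrM -natrD ler_nat.
  rewrite cardsD (setIidPr sT'S); have := subset_leq_card sT'S => le_T'S le_c.
  by rewrite -(leq_pmul2l (m := c.-1)); nia.
apply: (@leq_bigmax_cond _ _ (fun T : {set G} => #|T|)).
by rewrite sTS /= vT natrM.
Qed.

(** Marginals 1 and [c] of the valuation are marginals 0 and 1 of [beta], so diminishing marginals
    become the persistence of zero marginals. *)
Lemma beta_rank k : matroid_rank (r k).
Proof.
case: k => [i|]; last first.
  split=> [|S g|S T g sST]; rewrite !beta_None ?cards0 //.
    by rewrite cardsU1; case: (g \in S); lia.
  rewrite !cardsU1; case: (boolP (g \in S)) => [/(subsetP sST)->//|_]; lia.
have r_eq S T m : v i S = (v i T + m%:R)%R ->
    #|S| + c.-1 * r (Some i) S = #|T| + c.-1 * r (Some i) T + m.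
  by rewrite !valuation_beta -natrD => /natr_inj.
have r_setU1 S g : g \notin S ->
    v i (g |: S) = (v i S + 1)%R /\ r (Some i) (g |: S) = r (Some i) S \/
    v i (g |: S) = (v i S + c%:R)%R /\ r (Some i) (g |: S) = (r (Some i) S).+1.
  move=> gS; have [vg|vg] := SUB_setU1 (v_SUB i) gS; [left|right]; split=> //.
    have := r_eq _ _ 1 vg; rewrite cardsU1 gS => e.
    by apply/eqP; rewrite -(eqn_pmul2l (m := c.-1)); [apply/eqP|]; lia.
  have := r_eq _ _ c vg; rewrite cardsU1 gS => e.
  by apply/eqP; rewrite -(eqn_pmul2l (m := c.-1)) ?mulnS; [apply/eqP|]; lia.
split=> [|S g|S T g sST].
- have := valuation_beta i set0; case: (v_SUB i) => _ -> _ _.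
  rewrite cards0 add0n => /esym/eqP; rewrite pnatr_eq0 muln_eq0.
  by case/orP => /eqP; lia.
- have [gS|gS] := boolP (g \in S); first by rewrite (setUidPr _) ?sub1set //;
    lia.
  by case: (r_setU1 S g gS) => -[_ ->]; lia.
have [gT|gT] := boolP (g \in T).
  by rewrite [g |: T](setUidPr _) ?sub1set.
have gS : g \notin S by apply: contra gT; apply: (subsetP sST).
case: (r_setU1 S g gS) => -[vS rS]; last by rewrite rS; lia.
move=> _; case: (r_setU1 T g gT) => -[vT //].
case: (v_SUB i) => _ _ _ /(_ S T g sST gT); rewrite /marginal vS vT.
rewrite ![(_ + _ - _)%R]addrAC !subrr !add0r => c_le1.
by move: c_gt1; rewrite -(ltr1n R) ltNge c_le1.
Qed.

(** In a clean bundle, deleting [g] lowers the rank by one, and adding [z] restores it exactly when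
    [z] is outside the remaining span. *)
Lemma exchange_edgeE X : clean r X -> exchange_edge c v X =2 swap_edge r X.
Proof.
move=> /cleanP iX g z; rewrite /swap_edge /exchange_edge.
set B := bundle X (X g) :\ g;
  have gX : g \in bundle X (X g) by rewrite in_bundle.
have rB : r (X g) (bundle X (X g)) = (r (X g) B).+1.
  have /eqP -> := indepS (beta_rank (X g)) (subsetDl _ [set g]) (iX (X g)).
  by rewrite (eqP (iX (X g))) (cardsD1 g) gX.
have -> : (z \notin mclosure (r (X g)) B) =
          (r (X g) (z |: B) == r (X g) (bundle X (X g))).
  by rewrite in_closure rB; have := rank_step (beta_rank (X g)) B z; lia.
apply/existsP/idP => [[j]|]; first by rewrite in_bundle => /andP[/eqP <-].
by move=> e; exists (X g); rewrite gX.
Qed.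

Lemma improvingE X k : improving c v X k = addable r X k.
Proof.
apply/setP => g; rewrite in_addable in_closure inE.
by have := rank_step (beta_rank k) (bundle X k) g; lia.
Qed.

Lemma exchange_pathE X i g q : clean r X ->
  exchange_path c v X i g q =
  [&& g \in addable r X (Some i), path (swap_edge r X) g q
    & last g q \in bundle X None].
Proof.
by move=> cX; rewrite /exchange_path improvingE (eq_path (exchange_edgeE cX)).
Qed.

End ValuationRank.

(** * Correctness of the algorithm for concave welfare *)

(** A basis of [S], built greedily; it serves to clean an arbitrary allocation. *)
Lemma rank_witness (G : finType) (r : {set G} -> nat) (S : {set G}) :
  matroid_rank r -> exists T : {set G}, [/\ T \subset S, indep r T & #|T| =
    r S].
Proof.
move=> r_rank; elim/set_elim: S => [|x A xA [T [sTA iT rT]]].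
  by exists set0; rewrite sub0set /indep; case: r_rank => -> _ _;
    rewrite cards0.
have [xT|xT] := boolP (x \in mclosure r T); last first.
  have xNT : x \notin T by apply: contra xT => /(sub_closure r).
  exists (x |: T); split; [exact: setUS|exact: indepU1|].
  have /andP[le1 le2] := rank_step r_rank A x.
  have := rankS r_rank (setUS [set x] sTA).
  by rewrite (eqP (indepU1 r_rank iT xT)) cardsU1 xNT rT; lia.
exists T; split=> //; first by apply: subset_trans sTA (subsetUr _ _).
apply/eqP; rewrite eqn_leq -{1}(eqP iT) (rankS r_rank) /=; last first.
  by apply: subset_trans sTA (subsetUr _ _).
suff /eqP -> : r (x |: A) == r A by rewrite rT.
by rewrite -in_closure; apply: (mclosureS r_rank sTA).
Qed.

Section Gains.
Variables (R : realType) (n : nat) (G : finType).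
Variable phi : allocation n G -> 'I_n -> R -> R.
Implicit Types (s : ys_state n G) (A : {set 'I_n}) (d : R) (i k : 'I_n).

Lemma max_gain_ge s A d k : k \in A ->
  ((phi (ys_output s) k d)%:E <= max_gain phi s A d)%E.
Proof.
by move=> kA; apply: (le_bigmax_cond _ (fun k => (phi (ys_output s) k d)%:E)).
Qed.

Lemma ex_first_max_gain s A d k : k \in A ->
  exists i, first_max_gain phi s A d i.
Proof.
move=> kA; pose F k := phi (ys_output s) k d.
have [k1 k1A k1max] : exists2 k1, k1 \in A & forall k, k \in A ->
  (F k <= F k1)%R.
  by case: (arg_maxP F kA) => k1 k1A k1max; exists k1.
have Fk1 : (F k1)%:E = max_gain phi s A d.
  apply/eqP; rewrite eq_le max_gain_ge //=; apply/bigmax_leP.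
  by split=> [|j jA]; rewrite ?leNye // lee_fin k1max.
pose P k := (k \in A) && ((F k)%:E == max_gain phi s A d).
have Pk1 : P k1 by rewrite /P k1A Fk1 eqxx.
case: (@arg_minnP _ k1 P (fun k => k : nat) Pk1) => i /andP[iA /eqP Fi] imin.
by exists i; split=> // j [jA Fj]; apply: imin; rewrite /P jA; apply/eqP.
Qed.

End Gains.

Section YankeeSwapCorrectness.
Variables (R : realType) (n : nat) (G : finType) (c : nat).
Variable v : 'I_n -> {set G} -> R.
Variable phi : allocation n G -> 'I_n -> R -> R.
Variables (gain : nat -> nat -> R) (W : nat -> R).
Hypothesis n_gt0 : 0 < n.
Hypothesis c_gt1 : 1 < c.
Hypothesis v_SUB : forall i, oneC_SUB c (v i).
Hypothesis W_mono : forall x, (W x <= W x.+1)%R.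
Hypothesis W_concave : forall x, (W x.+2 - W x.+1 <= W x.+1 - W x)%R.
Hypothesis phi_gain : forall X k (u d : nat),
  utility v X k = u%:R%R -> phi X k d%:R%R = gain u d.
(** These comparisons say what a choice by gains implies for utilities and for increments of [W].
    They are kept abstract because the gain at utility 0 will differ from the increment. *)
Hypothesis gain_cc : forall x y, (gain y c <= gain x c)%R -> x <= y.
Hypothesis gain_1c : forall x y, (gain y 1 <= gain x c)%R ->
  (W y.+1 - W y <= W (x + c) - W x)%R.
Hypothesis gain_11 : forall x y, (gain y 1 <= gain x 1)%R ->
  (W y.+1 - W y <= W x.+1 - W x)%R.
Hypothesis gain_c1 : forall x y, (gain y c < gain x 1)%R ->
  (W (y + c) - W y <= W x.+1 - W x)%R.
Implicit Types (s : ys_state n G) (X Y Z : allocation n G) (i j k : 'I_n).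
Local Notation r := (beta c v).
Let r_rank := beta_rank c_gt1 v_SUB.
Let r_None := @beta_None R n G c v.

Definition nat_utility X k : nat :=
  #|bundle X (Some k)| + c.-1 * r (Some k) (bundle X (Some k)).

Lemma utilityE X k : utility v X k = (nat_utility X k)%:R%R.
Proof. exact: valuation_beta. Qed.

Definition welfare X : R := (\sum_k W (nat_utility X k))%R.

Definition extra s k : nat := #|bundle (ys_extra s) (Some k)|.

Definition ys_invariant s : Prop :=
  [/\ clean r (ys_clean s),
      forall g, ys_extra s g != None -> ys_clean s g = None,
      forall k, k \in ys_active s -> extra s k = 0,
      forall k, k \notin ys_active s -> tight r (ys_clean s) k
    & forall Y, dominated c r W (ys_clean s) (extra s) (welfare Y)].

Definition level s k : nat := c * #|bundle (ys_clean s) (Some k)| + extra s k.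

(** Only agents outside [U] hold extra goods. Being tight, such an agent already spans every good
    unallocated in the clean part, so each extra good is worth 1. *)
Lemma clean_nat_utility s k : ys_invariant s ->
  nat_utility (ys_output s) k = level s k.
Proof.
case=> cX supp act tX _; rewrite /nat_utility /level /extra.
have -> : bundle (ys_output s) (Some k) =
          bundle (ys_extra s) (Some k) :|: bundle (ys_clean s) (Some k).
  apply/setP => g; rewrite !inE ffunE; have := supp g.
  by case: (ys_extra s g) => [j|] => [->|] //=; rewrite orbF.
set E := bundle (ys_extra s) _; set B := bundle (ys_clean s) _.
have -> : r (Some k) (E :|: B) = #|B|.
  rewrite (rank_closure (r_rank (Some k))); first exact/eqP/(cleanP _ _ cX).
  apply/subsetP => g; rewrite in_bundle => /eqP gE.
  have gN : ys_clean s g = None by apply: supp; rewrite gE.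
  have kU : k \notin ys_active s.
    apply: contraTN isT => /act /eqP; rewrite cards_eq0 => /eqP E0.
    by have := in_set0 g; rewrite -E0 in_bundle gE eqxx.
  apply/negPn; rewrite -in_addable; apply/negP => gB.
  have sz (j : option 'I_n) := card_bundle_reassign j (addable_notin gB).
  rewrite gN in sz; have := tX k kU _ (clean_reassign r_rank cX gB).
  have := sz (Some k); rewrite eqxx /= => szk tk.
  suff /tk : forall j, #|bundle (ys_clean s) (Some j)| <=
      #|bundle (reassign (ys_clean s) g (Some k)) (Some j)| by lia.
  by move=> j; have := sz (Some j); rewrite /=; lia.
have : E :&: B = set0.
  apply/setP => g; rewrite !inE; have := supp g.
  by case: (ys_extra s g) => // j ->; rewrite ?andbF.
by rewrite cardsU => ->; rewrite cards0 subn0; case: c c_gt1 => // c' _ /=; lia.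
Qed.

Lemma phi_output s k (d : nat) : ys_invariant s ->
  phi (ys_output s) k d%:R%R = gain (level s k) d.
Proof. by move=> inv; apply: phi_gain; rewrite utilityE clean_nat_utility. Qed.

Lemma init_invariant : ys_invariant (ys_init n G).
Proof.
have none (X : allocation n G) j : X = [ffun=> None] ->
  #|bundle X (Some j)| = 0.
  by move=> ->; apply: eq_card0 => g; rewrite !inE ffunE.
split=> [|g|k _|k|Y]; rewrite /= ?ffunE //.
- apply/cleanP => -[k|]; rewrite /indep.
    have /eqP := none _ k erefl; rewrite cards_eq0 => /eqP ->.
    by rewrite cards0; case: (r_rank (Some k)) => ->.
  by rewrite r_None.
- exact: none.
- by rewrite inE.
(* Each bundle of [Y] is cut down to a basis; the discarded goods are counted as goods of value
   1. *)
have /fin_all_exists[T TP] := fun k : 'I_n =>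
  rank_witness (bundle Y (Some k)) (r_rank (Some k)).
pose Z : allocation n G :=
  [ffun g => if Y g is Some k then if g \in T k then Some k else None else
    None].
have ZT k : bundle Z (Some k) = T k.
  have [sTY _ _] := TP k; apply/setP => g; rewrite in_bundle ffunE.
  apply/idP/idP => [|gT]; last first.
    by have := subsetP sTY g gT; rewrite in_bundle => /eqP ->; rewrite gT.
  by case: (Y g) => // j; case: ifP => // gT /eqP[<-].
exists Z, (fun k => #|bundle Y (Some k)| - #|T k|); split.
- apply/cleanP => -[k|]; last by rewrite /indep r_None.
  by rewrite ZT; case: (TP k).
- by move=> j; rewrite none.
- by move=> j; rewrite /extra none.
- have := card_bundles Z; have := card_bundles Y.
  have -> : \sum_j #|bundle Y (Some j)| =
      \sum_j (#|bundle Y (Some j)| - #|T j|) + \sum_j #|bundle Z (Some j)|.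
    rewrite -big_split; apply: eq_bigr => j _; rewrite ZT /= subnK //.
    by case: (TP j) => /subset_leq_card.
  by move=> /=; lia.
- rewrite le_eqVlt; apply/orP; left; apply/eqP; apply: eq_bigr => k _; congr W.
  rewrite ZT /nat_utility; case: (TP k) => /subset_leq_card leT _ rT.
  by rewrite -rT; case: c c_gt1 => // c' _ /=; lia.
Qed.

Lemma replace_extraE s z X1 : ys_invariant s -> ys_clean s z = None ->
  replace_extra s z X1 ->
  (forall k, #|bundle X1 (Some k)| = extra s k) /\
  (forall g, X1 g != None -> ys_clean s g = None /\ g != z).
Proof.
case=> _ supp _ _ _ zN; rewrite /replace_extra.
case Ez: (ys_extra s z) => [j|] => [[g /andP[/eqP gN /eqP gE] ->]|->];
  last first.
  split=> // g gE; split; first exact: supp.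
  by apply: contraNneq gE => ->; rewrite Ez.
have gz : g != z by apply: contraTneq isT => gz; move: Ez; rewrite -gz gE.
have -> : [ffun x => if x == z then None else if x == g then Some j
                     else ys_extra s x] =
          reassign (reassign (ys_extra s) z None) g (Some j).
  apply/ffunP => x; rewrite !ffunE; case: (eqVneq x g) => [->|//].
  by rewrite (negPf gz).
split=> [k|x].
  have := card_bundle_reassign (X := reassign (ys_extra s) z None) (g := g)
            (o := Some j) (Some k).
  rewrite ffunE (negPf gz) gE => /(_ isT).
  have := card_bundle_reassign (X := ys_extra s) (g := z) (o := None) (Some k).
  by rewrite Ez => /(_ isT); rewrite /extra /=; lia.
rewrite !ffunE; case: (eqVneq x g) => [-> //|xg];
  case: (eqVneq x z) => // xz xE.
by split=> //; apply: supp.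
Qed.

(** A shortest path meets the unallocated goods only at its end, since otherwise it could stop
    earlier. Hence the extra goods stay unallocated in the clean part. *)
Lemma augment_unallocated X i g q x : clean r X ->
  shortest_exchange_path c v X i g q -> X x = None -> x != last g q ->
  augment X i (g :: q) x = None.
Proof.
move=> cX [+ min_q]; rewrite (exchange_pathE c_gt1 v_SUB) // => /and3P[gX pq _].
move=> xN xl; rewrite ffunE; case: ifP => // xq.
case/splitPl: q / xq pq xl min_q => q1 q2 lq1; rewrite cat_path last_cat lq1.
case/andP=> pq1 _ xl min_q; have := min_q g q1.
rewrite (exchange_pathE c_gt1 v_SUB) // gX pq1 lq1 in_bundle xN eqxx =>
  /(_ isT).
by move: xl; case: q2 {min_q} => [|y q2]; rewrite ?eqxx // size_cat /=; lia.
Qed.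

Lemma eq_dominated X (b b' : 'I_n -> nat) t : b =1 b' ->
  dominated c r W X b t -> dominated c r W X b' t.
Proof.
by move=> eb [Y [f [? ? bf ? ?]]]; exists Y, f; split=> // j; rewrite -eb.
Qed.

Lemma prefer_c_gains s i : ys_invariant s -> prefer_c c phi s ->
  first_max_gain phi s (ys_active s) c%:R%R i ->
  (forall k, k \in ys_active s ->
    (gain (level s k) c <= gain (level s i) c)%R) /\
  (forall k, k \notin ys_active s ->
    (gain (level s k) 1 <= gain (level s i) c)%R).
Proof.
move=> inv pref [[_ iE] _]; split=> k kU.
  by rewrite -!phi_output // -lee_fin iE max_gain_ge.
rewrite -!phi_output // -lee_fin iE; apply: le_trans pref.
by apply: max_gain_ge; rewrite inE.
Qed.

Lemma prefer_1_gains s i : ys_invariant s -> ~~ prefer_c c phi s ->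
  first_max_gain phi s (~: ys_active s) 1%R i ->
  (forall k, k \in ys_active s ->
    (gain (level s k) c < gain (level s i) 1)%R) /\
  (forall k, k \notin ys_active s ->
    (gain (level s k) 1 <= gain (level s i) 1)%R).
Proof.
move=> inv; rewrite -ltNge => pref [[_ iE] _]; split=> k kU.
  rewrite -!phi_output // -lte_fin iE; apply: le_lt_trans pref.
  exact: max_gain_ge.
by rewrite -!phi_output // -lee_fin iE; apply: max_gain_ge; rewrite inE.
Qed.

(** Each iteration lowers one of the two summands and keeps the other; the loop condition keeps the
    subtraction from truncating. *)
Definition ys_measure s : nat :=
  #|bundle (ys_clean s) None| - \sum_(k < n) extra s k + #|ys_active s|.

Lemma step_invariant s s' : ys_invariant s -> ys_continue s ->
  ys_step c v phi s s' -> ys_invariant s' /\ ys_measure s' < ys_measure s.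
Proof.
move=> inv; have [cX supp act tX dom] := inv; move=> cont.
have {}cont : \sum_(k < n) extra s k < #|bundle (ys_clean s) None| := cont.
case=> [i g q X1 pref imax short repl|i pref imax nopath|i g pref imax free].
- have [gc g1] := prefer_c_gains inv pref imax; case: imax => -[iU _] _.
  have [] := short; rewrite (exchange_pathE c_gt1 v_SUB) // =>
    /and3P[gX pq lq] min_q.
  have lN : ys_clean s (last g q) = None by move: lq; rewrite in_bundle => /eqP.
  have [eX1 suppX1] := replace_extraE inv lN repl.
  have [|cX' sX'] := shift_shortest (B := mem (bundle (ys_clean s) None))
     r_rank cX gX pq lq.
    move=> g' q' g'X pq' lq'; apply: (min_q g').
    by rewrite (exchange_pathE c_gt1 v_SUB) // g'X pq'.
  rewrite lN in sX'; set X' := augment (ys_clean s) i (g :: q).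
  have {}cX' : clean r X' := cX'.
  have {}sX' (k : option 'I_n) : #|bundle X' k| + (None == k) =
    #|bundle (ys_clean s) k| + (Some i == k) := sX' k.
  have leX k : #|bundle (ys_clean s) (Some k)| <=
               #|bundle X' (Some k)|.
    by have := sX' (Some k); rewrite /=; lia.
  split; last first.
    have eS : \sum_(k < n) extra (YsState X' X1 (ys_active s)) k =
      \sum_(k < n) extra s k.
      by apply: eq_bigr => k _; apply: eX1.
    rewrite /ys_measure eS /= ltn_add2r; have := sX' None.
    by rewrite eqxx /= addn0 addn1 => eN; rewrite -eN in cont *;
      exact: ltn_sub2r.
  split=> //=.
  + by move=> x /suppX1[xN xl]; apply: augment_unallocated.
  + by move=> k kU; rewrite /extra /= eX1 act.
  (* Tightness persists: no agent loses clean goods, so a [Z] above the new allocation is above the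
     old one. *)
  + move=> k kU Z cZ leZ; apply/eqP; rewrite eqn_leq leZ andbT.
    by rewrite (tX k kU) // => j; apply: leq_trans (leX j) (leZ j).
  + move=> Y; apply: (@eq_dominated _ (extra s)) => [k|]; first by rewrite -eX1.
    apply: (dominated_augment r_rank (ltnW c_gt1) W_mono W_concave cX' sX' iU)
      => //.
      move=> k kU; have := gain_cc (gc k kU).
      by rewrite /level !act // !addn0 leq_pmul2l // ltnW.
    by move=> k kU; have := gain_1c (g1 k kU); rewrite /level (act i iU) addn0.
- case: imax => -[iU _] _; split; last first.
    have -> : ys_measure s = (ys_measure (YsState (ys_clean s) (ys_extra s)
                                            (ys_active s :\ i))).+1.
      by rewrite [LHS]/ys_measure (cardsD1 i (ys_active s)) iU add1n addnS.
    exact: ltnSn.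
  split=> //= k; rewrite ?inE; first by case/andP=> _; apply: act.
  rewrite negb_and negbK => /orP[/eqP ->|]; last exact: tX.
  move=> Z cZ leZ; apply/eqP; rewrite eqn_leq leZ andbT leqNgt;
    apply/negP => ltZ.
  (* Were [i] not tight, there would be a reachable good whose owner holds fewer goods in [Z]. This
     owner can only be the dummy agent, which gives an exchange path. *)
  have [x /reachableP[g [q [gX pq lq]]]] := exchange r_rank cX cZ ltZ.
  case xX: (ys_clean s x) => [j|] lt_x; first by have := leZ j; lia.
  have := nopath g q; rewrite (exchange_pathE c_gt1 v_SUB) // gX pq lq.
  by rewrite in_bundle xX.
- have [gc g1] := prefer_1_gains inv pref imax; case: imax => -[+ _] _.
  rewrite inE => iU; case/andP: free => /eqP gN /eqP gE.
  rewrite -/(reassign (ys_extra s) g (Some i)).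
  set X1 := reassign _ _ _.
  have eX1 k : #|bundle X1 (Some k)| = extra s k + (k == i).
    have := card_bundle_reassign (X := ys_extra s) (g := g) (o := Some i) (Some
      k).
    by rewrite gE => /(_ isT); rewrite /= addn0 => ->;
      rewrite (inj_eq Some_inj) eq_sym.
  split; last first.
    have eS : \sum_(k < n) extra (YsState (ys_clean s) X1 (ys_active s)) k =
              (\sum_(k < n) extra s k).+1.
      apply: (sum_incr (i := i)) => [k /negPf ki|]; rewrite /extra /= eX1.
        by rewrite ki addn0.
      by rewrite eqxx addn1.
    by rewrite /ys_measure eS /= ltn_add2r subnS ltn_predL subn_gt0.
  split=> //=.
  + by move=> x; rewrite ffunE; case: (x =P g) => [-> //|_]; apply: supp.
  + move=> k kU; rewrite /extra /= eX1 act //.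
    by case: eqP kU iU => // -> ->.
  + move=> Y; apply: (@eq_dominated _ (fun k => extra s k + (k == i))) => [k|].
      by rewrite -eX1.
    apply: (dominated_extra r_rank r_None (ltnW c_gt1) W_mono W_concave iU) =>
      //.
      by move=> k kU; apply: gain_11; apply: g1.
    by move=> k kU; apply: gain_c1; apply: gc.
Qed.

Lemma ex_free_good s : ys_invariant s -> ys_continue s ->
  exists g, free_good s g.
Proof.
case=> _ supp _ _ _; rewrite /ys_continue => cont; apply/existsP.
rewrite -[[exists _, _]]negbK; apply/negP => /existsPn nofree.
move: cont; rewrite ltnNge => /negP[].
rewrite -(leq_add2l #|bundle (ys_extra s) None|) card_bundles addnC.
rewrite -cardsUI (_ : _ :&: _ = set0) ?cards0 ?addn0 ?max_card //.
by apply/setP => g; rewrite !inE; apply: negbTE; apply: nofree.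
Qed.

Lemma ex_step s : ys_invariant s -> ys_continue s ->
  exists s', ys_step c v phi s s'.
Proof.
move=> inv cont; have [cX supp act tX _] := inv.
have [g0 free] := ex_free_good inv cont.
have [pref|pref] := boolP (prefer_c c phi s).
  have [k kU] : exists k, k \in ys_active s.
    (* With [U] empty the gain for [c] is [-oo], below the finite gain of an agent outside [U]. *)
    apply/set0Pn; apply/eqP => U0; move: pref; rewrite /prefer_c U0.
    have := @max_gain_ge R n G phi s (~: set0) 1%R (Ordinal n_gt0).
    rewrite !inE => /(_ isT) ge1 le1; move: (le_trans ge1 le1).
    by rewrite /max_gain big_set0 leeNy_eq.
  have [i imax] := ex_first_max_gain phi s c%:R%R kU.
  have [[g [q pq]]|nopath] :=
      pselect (exists g q, exchange_path c v (ys_clean s) i g q); last first.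
    exists (YsState (ys_clean s) (ys_extra s) (ys_active s :\ i)).
    by apply: YsDeactivate => // g q; apply/negP => pq; apply: nopath;
      exists g, q.
  have [g' [q' short]] := ex_shortest (P := exchange_path c v (ys_clean s) i)
    pq.
  have [X1 repl] : exists X1, replace_extra s (last g' q') X1.
    rewrite /replace_extra; case: (ys_extra s (last g' q')) => [j|].
      by eexists; exists g0.
    by exists (ys_extra s).
  by eexists; apply: YsAugment pref imax short repl.
have [k kU] : exists k, k \in ~: ys_active s.
  apply/set0Pn; apply: contraNneq pref => U0.
  by rewrite /prefer_c U0 {1}/max_gain big_set0 leNye.
have [i imax] := ex_first_max_gain phi s 1%R kU.
by eexists; apply: YsExtra pref imax free.
Qed.

Theorem ys_correct (Q : allocation n G -> Prop) :
  (forall X, (forall Y, (welfare Y <= welfare X)%R) -> Q X) ->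
  yankee_swap_computes c v phi Q.
Proof.
move=> optQ; rewrite /yankee_swap_computes.
have : ys_invariant (ys_init n G) by exact: init_invariant.
move: (ys_init n G) => s; have [m] := ubnP (ys_measure s).
elim: m s => // m IH s lt_m inv.
have [cont|stop] := boolP (ys_continue s); last first.
  apply: YsDone => //; apply: optQ => Y; have [_ _ _ _ dom] := inv.
  apply: le_trans (dominated_le (ltnW c_gt1) _ (dom Y)) _.
    by move: stop; rewrite /ys_continue -leqNgt.
  rewrite /welfare [leRHS](eq_bigr (fun j => W (level s j))) // => j _.
  by rewrite clean_nat_utility.
apply: YsLoop => // [|s' /(step_invariant inv cont)[inv' lt_s']].
  exact: ex_step.
by apply: IH => //; lia.
Qed.

End YankeeSwapCorrectness.

(** * Power welfare *)

Local Open Scope ring_scope.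

Section PowerWelfare.
Variables (R : realType) (p : R).
Hypothesis p_lt1 : p < 1.
Hypothesis p_neq0 : p != 0.

(** The sign makes the function increasing and strictly concave on the positive reals in both
    cases. *)
Definition signed_pow (x : R) : R := if 0 < p then x `^ p else - x `^ p.

(* The tangent inequality at 1. It combines [1 + y < expR y] at the two
   endpoints when 0 < p, and at the two exponents when p < 0. *)
Lemma signed_pow_tangent (x : R) : 0 < x -> x != 1 ->
  signed_pow x < if 0 < p then 1 + p * (x - 1) else - (1 + p * (x - 1)).
Proof.
move=> x_gt0 x_neq1; rewrite /signed_pow /powR gt_eqF //.
have xE := lnK x_gt0; set t := ln x in xE *.
have t_neq0 : t != 0 by apply: contraNneq x_neq1 => t0; rewrite -xE t0 expR0.
rewrite -xE; have [p_gt0|p_le0] := ltP 0 p.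
  have e1 : 1 + (1 - p) * t < expR ((1 - p) * t).
    by apply: expR_gt1Dx; rewrite mulf_neq0 // subr_eq0 gt_eqF.
  have e0 : 1 + - (p * t) < expR (- (p * t)).
    by apply: expR_gt1Dx; rewrite oppr_eq0 mulf_neq0.
  have ept : 0 < expR (p * t) := expR_gt0 _.
  have -> : expR t = expR (p * t) * expR ((1 - p) * t).
    by rewrite -expRD; congr expR; ring.
  have ee : expR (p * t) * expR (- (p * t)) = 1 by rewrite -expRD subrr expR0.
  set E := expR (p * t) in ept ee *; set A := expR _ in e1 *.
  set B := expR _ in e0 ee.
  have q_gt0 : 0 < 1 - p by rewrite subr_gt0.
  have h1 : E * p * (1 + (1 - p) * t) < E * p * A by rewrite ltr_pM2l //
    mulr_gt0.
  have h0 : E * (1 - p) * (1 + - (p * t)) < E * (1 - p) * B.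
    by rewrite ltr_pM2l // mulr_gt0.
  (* Because [E * B = 1], the tangent value is a sum with weights [p] and [1 - p]; the two linear
     lower bounds then add up to [E]. *)
  have -> : 1 + p * (E * A - 1) = E * p * A + E * (1 - p) * B.
    by transitivity (E * p * A + (1 - p) * (E * B)); [rewrite ee|]; ring.
  apply: le_lt_trans (ltrD h1 h0); rewrite le_eqVlt; apply/orP; left; apply/eqP.
  ring.
have p_lt0 : p < 0 by rewrite lt_neqAle p_neq0.
have e1 := @expR_gt1Dx R (p * t) (mulf_neq0 p_neq0 t_neq0).
have h1 : p * expR t < p * (1 + t) by rewrite ltr_nM2l // expR_gt1Dx.
move: e1 h1; set E := expR (p * t); set F := expR t; lra.
Qed.

Lemma signed_pow_lt (x y : R) : 0 < x -> x < y -> signed_pow x < signed_pow y.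
Proof.
move=> x0 xy; have y0 := lt_trans x0 xy; rewrite /signed_pow /powR !gt_eqF //.
have ltl : ln x < ln y by rewrite ltr_ln.
have [p_gt0|p_le0] := ltP 0 p; first by rewrite ltr_expR ltr_pM2l.
by rewrite ltrN2 ltr_expR ltr_nM2l // lt_neqAle p_neq0.
Qed.

(** Dividing by [x + 1] moves the middle point to 1, and the tangent there lies strictly above the
    function at both symmetric neighbours. *)
Lemma signed_pow_concave (x : R) : 0 < x ->
  signed_pow (x + 2) - signed_pow (x + 1) < signed_pow (x + 1) - signed_pow x.
Proof.
move=> x0; have y0 : 0 < x + 1 by lra.
have scale z : 0 < z ->
    signed_pow z = (x + 1) `^ p * signed_pow (z / (x + 1)).
  move=> z0; rewrite /signed_pow;
    have -> : z `^ p = (x + 1) `^ p * (z / (x + 1)) `^ p.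
    rewrite -powRM ?ltW ?divr_gt0 //; congr (_ `^ _); field; lra.
  by case: ifP => _ //; rewrite mulrN.
have P0 : 0 < (x + 1) `^ p by apply: powR_gt0.
rewrite (scale (x + 2)) ?(scale x) ?(scale (x + 1)) //; last by lra.
rewrite divff ?gt_eqF // -!mulrBr ltr_pM2l //.
have y_unit : x + 1 != 0 by rewrite gt_eqF.
have e2 : (x + 2) / (x + 1) = 1 + (x + 1)^-1 by field.
have e0 : x / (x + 1) = 1 - (x + 1)^-1 by field.
have i0 : 0 < (x + 1)^-1 by rewrite invr_gt0.
have n2 : (x + 2) / (x + 1) != 1 by rewrite e2 gt_eqF // ltrDl.
have n0 : x / (x + 1) != 1 by rewrite e0 lt_eqF // ltrBlDr ltrDl.
have t2 := signed_pow_tangent (divr_gt0 (ltr_wpDr (ler0n _ 2) x0) y0) n2.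
have t0 := signed_pow_tangent (divr_gt0 x0 y0) n0.
rewrite e2 e0 in t0 t2 *.
have -> : signed_pow 1 = if 0 < p then 1 else - 1.
  by rewrite /signed_pow powR1.
move: t2 t0; set i := (x + 1)^-1; case: ifP => _.
  by move=> t2 t0; nra.
by move=> t2 t0; nra.
Qed.

End PowerWelfare.

(** * Agent welfare and gains for the p-mean *)

Section PMeanYankeeSwap.
Variables (R : realType) (p : R) (c : nat).
Hypothesis p_lt1 : p < 1.
Hypothesis p_neq0 : p != 0.
Hypothesis c_gt1 : (1 < c)%N.

Definition agent_welfare (M : R) (u : nat) : R :=
  if u == 0%N then - M else signed_pow p u%:R.

(** At utility 0 the gain [M * d] is not the increment [M + w d] of [agent_welfare] for positive
    [d], so gains and increments are compared by cases. *)
Definition agent_gain (M : R) (u d : nat) : R :=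
  if u == 0%N then M * d%:R else signed_pow p (u + d)%:R - signed_pow p u%:R.

Local Notation w u := (signed_pow p (u%:R)).

Lemma natpow_lt (u m : nat) : (0 < u)%N -> (u < m)%N -> w u < w m.
Proof. by move=> u0 um; apply: signed_pow_lt; rewrite // ?ltr0n ?ltr_nat. Qed.

Lemma natpow_le (u m : nat) : (0 < u)%N -> (u <= m)%N -> w u <= w m.
Proof.
by move=> u0; rewrite leq_eqVlt => /orP[/eqP->//|/(natpow_lt u0)/ltW].
Qed.

Lemma natpow_step (u m : nat) : (0 < u)%N -> (u < m)%N ->
  w m.+1 - w m < w u.+1 - w u.
Proof.
move=> u0; have step z : (0 < z)%N -> w z.+2 - w z.+1 < w z.+1 - w z.
  move=> z0; have := signed_pow_concave p_lt1 p_neq0 (_ : 0 < z%:R).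
  by rewrite ltr0n z0 => /(_ isT); rewrite -natrD addn2 natr1.
elim: m => // m IH; rewrite ltnS leq_eqVlt => /orP[/eqP <-|um];
  first exact: step.
by apply: lt_trans (IH um); apply: step; apply: leq_trans um.
Qed.

Lemma natpow_gain (d u m : nat) : (0 < d)%N -> (0 < u)%N -> (u < m)%N ->
  w (m + d) - w m < w (u + d) - w u.
Proof.
move=> d0 u0 um; elim: d d0 => // d IH _.
have := @natpow_step (u + d) (m + d); rewrite ltn_add2r !addnS => /(_ _ um).
rewrite addn_gt0 u0 => /(_ isT); case: (posnP d) => [->|/IH];
  rewrite ?addn0 //; lra.
Qed.

Lemma natpow_gain_le (d u m : nat) : (0 < u)%N -> (u <= m)%N ->
  w (m + d) - w m <= w (u + d) - w u.
Proof.
move=> u0; case: d => [|d]; first by rewrite !addn0 !subrr.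
by rewrite leq_eqVlt => /orP[/eqP->//|/(natpow_gain (ltn0Sn d) u0)/ltW].
Qed.

Lemma signed_pow1 : `|w 1| = 1.
Proof. by rewrite /signed_pow powR1; case: ifP => _;
  rewrite ?normrN normr1. Qed.

Section LargeM.
Variable M : R.
(** By concavity the step from 1 to [1 + c] bounds every increment by at most [c] at positive
    utility; the additional 1 absorbs [w 1], which is 1 or -1. *)
Hypothesis M_large : w (1 + c) - w 1 + 1 < M.

Lemma w1_bounds : - 1 <= w 1 <= 1.
Proof. by rewrite -ler_norml signed_pow1. Qed.

Lemma M_gt0 : 1 < M.
Proof.
have h : w 1 < w (1 + c) by apply: natpow_lt; lia.
by apply: lt_trans M_large; rewrite -subr_gt0 addrK subr_gt0.
Qed.

Lemma small_gain (d u : nat) : (0 < u)%N -> (d <= c)%N ->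
  w (u + d) - w u < M - 1.
Proof.
move=> u0 dc; have := @natpow_gain_le d 1 u isT u0.
have := @natpow_le (1 + d) (1 + c) isT; rewrite leq_add2l => /(_ dc).
by move: M_large; lra.
Qed.

Lemma agent_welfare_mono u : agent_welfare M u <= agent_welfare M u.+1.
Proof.
rewrite /agent_welfare /=; case: u => [|u] /=; last exact: natpow_le.
by have := w1_bounds; have := M_gt0; lra.
Qed.

Lemma agent_welfare_concave u :
  agent_welfare M u.+2 - agent_welfare M u.+1 <=
  agent_welfare M u.+1 - agent_welfare M u.
Proof.
rewrite /agent_welfare /=; case: u => [|u] /=; last exact/ltW/natpow_step.
have := @small_gain 1 1 isT (ltnW c_gt1); have := w1_bounds; rewrite addn1; lra.
Qed.

Lemma agent_gain_cc x y : agent_gain M y c <= agent_gain M x c -> (x <= y)%N.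
Proof.
rewrite leqNgt; apply: contraTN => yx; rewrite -ltNge /agent_gain.
have x0 : (0 < x)%N by apply: leq_ltn_trans yx.
rewrite (gtn_eqF x0); case: posnP => [_|y0]; last first.
  by apply: natpow_gain => //; apply: ltnW.
have := @small_gain c x x0 (leqnn c);
  have c1 : 1 <= c%:R :> R by rewrite ler1n ltnW.
by have := M_gt0; nra.
Qed.

Lemma agent_gain0 (d x : nat) : (d <= c)%N ->
  M <= agent_gain M x d -> x = 0%N.
Proof.
move=> dc; case: x => // x; rewrite /agent_gain leNgt => /negP[].
by have := @small_gain d x.+1 isT dc => /=; lra.
Qed.

Lemma agent_gain_pos (d x : nat) : (0 < x)%N ->
  agent_gain M x d = agent_welfare M (x + d) - agent_welfare M x.
Proof.
by move=> x0; rewrite /agent_gain /agent_welfare !gtn_eqF // addn_gt0 x0.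
Qed.

(** At positive utilities gains are increments. If [y] is 0, its gain [M] forces [x] to be 0; if [x]
    is 0, concavity and monotonicity suffice. *)
Lemma agent_gain_1c x y : agent_gain M y 1 <= agent_gain M x c ->
  agent_welfare M y.+1 - agent_welfare M y <=
  agent_welfare M (x + c) - agent_welfare M x.
Proof.
have mono1c z : agent_welfare M z.+1 <= agent_welfare M (z + c).
  apply: (W_homo agent_welfare_mono); rewrite -addn1 leq_add2l; exact: ltnW.
have [->|y0] := posnP y.
  rewrite {1}/agent_gain /= mulr1 => /(agent_gain0 (leqnn c)) ->.
  by have := mono1c 0%N; lra.
have [->|x0] := posnP x.
  move=> _; have := mono1c 0%N.
  by have := W_gain agent_welfare_concave 1 (leq0n y); rewrite !addn1; lra.
by rewrite !agent_gain_pos // addn1.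
Qed.

Lemma agent_gain_11 x y : agent_gain M y 1 <= agent_gain M x 1 ->
  agent_welfare M y.+1 - agent_welfare M y <=
  agent_welfare M x.+1 - agent_welfare M x.
Proof.
have [->|y0] := posnP y.
  by rewrite {1}/agent_gain /= mulr1 => /(agent_gain0 (ltnW c_gt1)) ->.
have [->|x0] := posnP x.
  by move=> _; have := W_gain agent_welfare_concave 1 (leq0n y); rewrite !addn1.
by rewrite !agent_gain_pos // !addn1.
Qed.

Lemma agent_gain_c1 x y : agent_gain M y c < agent_gain M x 1 ->
  agent_welfare M (y + c) - agent_welfare M y <=
  agent_welfare M x.+1 - agent_welfare M x.
Proof.
have [->|y0] := posnP y.
  (* This case is impossible: a gain above [M * c] forces utility 0 at [x], where the gain is only
     [M]. *)
  rewrite {1}/agent_gain /= => lt_g; have c1 : 1 < c%:R :> R by rewrite ltr1n.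
  have /agent_gain0 x0 : M <= agent_gain M x 1 by have := M_gt0; nra.
  move: lt_g; rewrite x0 ?(ltnW c_gt1) // /agent_gain /= mulr1.
  by have := M_gt0; nra.
have [->|x0] := posnP x; last by rewrite !agent_gain_pos // addn1 => /ltW.
move=> _; rewrite -agent_gain_pos // /agent_gain /agent_welfare /= gtn_eqF //.
have := @small_gain c y y0 (leqnn c); have := w1_bounds; lra.
Qed.

End LargeM.

(** * From optimal welfare to max p-mean welfare *)

Variables (n : nat) (G : finType) (v : 'I_n -> {set G} -> R).
Hypothesis n_gt0 : (0 < n)%N.
Hypothesis v_SUB : forall i, oneC_SUB c (v i).
Implicit Types X Y : allocation n G.

Lemma p_mean_gainE M X k (u d : nat) :
  utility v X k = u%:R -> p_mean_gain v p M X k d%:R = agent_gain M u d.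
Proof.
move=> uE; rewrite /p_mean_gain /agent_gain uE pnatr_eq0; case: ifP => // _.
by rewrite /signed_pow natrD; case: ifP => // _; rewrite opprK addrC.
Qed.

Lemma positive_agentsE X k :
  (k \in positive_agents v X) = (0 < nat_utility c v X k)%N.
Proof. by rewrite inE (utilityE c_gt1 v_SUB) ltr0n. Qed.

Lemma nat_utility_le X k : (nat_utility c v X k <= c * #|G|)%N.
Proof.
rewrite /nat_utility; set B := bundle X _.
have := rank_card (beta_rank c_gt1 v_SUB (Some k)) B; have := max_card B.
by case: c c_gt1 => // c' _ /=; nia.
Qed.

Definition powsum X : R := \sum_(k in positive_agents v X) w (nat_utility c v X
  k).

Lemma welfareE M X :
  welfare c v (agent_welfare M) X =
  powsum X - M * (n%:R - #|positive_agents v X|%:R).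
Proof.
rewrite /welfare (bigID (mem (positive_agents v X))) /=; congr (_ + _).
  apply: eq_bigr => k; rewrite positive_agentsE => u0.
  by rewrite /agent_welfare gtn_eqF.
rewrite (eq_bigr (fun=> - M)) => [|k]; last first.
  by rewrite positive_agentsE -eqn0Ngt /agent_welfare => ->.
rewrite sumr_const -[LHS]mulr_natr mulNr; congr (- (_ * _)).
have /(congr1 (fun m => m%:R : R)) := cardC (positive_agents v X).
by rewrite card_ord natrD => <-; rewrite addrC addKr.
Qed.

(** A positive utility lies between 1 and [c * #|G|], and [w] is increasing with [w 1] at least
    -1. *)
Definition powbound : R := 1 + `|w (c * #|G|)%N|.

Lemma powsum_bound X : `|powsum X| <= n%:R * powbound.
Proof.
apply: le_trans (ler_norm_sum _ _ _) _.
apply: (@le_trans _ _ (\sum_(k in positive_agents v X) powbound)).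
  apply: ler_sum => k; rewrite positive_agentsE => u0.
  have := natpow_le u0 (nat_utility_le X k).
  have := @natpow_le 1 (nat_utility c v X k) isT u0.
  have := w1_bounds; have := ler_norm (w (c * #|G|)%N).
  have := normr_ge0 (w (c * #|G|)%N).
  rewrite /powbound => *; rewrite ler_norml; apply/andP; split; lra.
rewrite sumr_const -[leLHS]mulr_natl ler_wpM2r //; first by rewrite addr_ge0.
by rewrite ler_nat -[X in (_ <= X)%N]card_ord max_card.
Qed.

Lemma p_mean_welfareE X : p_mean_welfare v p X =
  (n%:R^-1 * \sum_(k in positive_agents v X) (nat_utility c v X k)%:R `^ p) `^
    p^-1.
Proof. by rewrite /p_mean_welfare;
  under eq_bigr do rewrite (utilityE c_gt1 v_SUB). Qed.

(** For negative [p] the sign in [signed_pow] and the outer exponent [p^-1] both reverse the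
    order. *)
Lemma powsum_max X Y :
  #|positive_agents v Y| = #|positive_agents v X| ->
  powsum Y <= powsum X -> p_mean_welfare v p Y <= p_mean_welfare v p X.
Proof.
move=> eqP; rewrite !p_mean_welfareE /powsum /signed_pow.
set sY := \sum_(k in positive_agents v Y) _ `^ p.
set sX := \sum_(k in positive_agents v X) _ `^ p.
have ni : 0 < n%:R^-1 :> R by rewrite invr_gt0 ltr0n.
have sY0 : 0 <= sY by apply: sumr_ge0 => k _; apply: powR_ge0.
have sX0 : 0 <= sX by apply: sumr_ge0 => k _; apply: powR_ge0.
have [p_gt0|p_le0] := ltP 0 p.
  move=> le_s; apply: ge0_ler_powR; rewrite ?nnegrE ?(mulr_ge0 (ltW ni)) //.
    by rewrite invr_ge0 ltW.
  by rewrite ler_pM2l.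
have p_lt0 : p < 0 by rewrite lt_neqAle p_neq0.
rewrite !sumrN lerN2 => le_s.
(* The decreasing power needs a positive base; without positive agents both sums are empty. *)
have [X0|[k kX]] := set_0Vmem (positive_agents v X).
  have Y0 : positive_agents v Y = finset.set0.
    by apply: cards0_eq; rewrite eqP X0 cards0.
  by rewrite /sY /sX X0 Y0 !big_set0.
have sX_gt0 : 0 < sX.
  rewrite /sX (bigD1 k) //= ltr_pwDl ?sumr_ge0 //.
  by apply: powR_gt0; rewrite ltr0n -positive_agentsE.
have a0 : 0 < n%:R^-1 * sX by rewrite mulr_gt0.
have ab : n%:R^-1 * sX <= n%:R^-1 * sY by rewrite ler_pM2l.
have b0 := lt_le_trans a0 ab.
rewrite /powR (gt_eqF a0) (gt_eqF b0) ler_expR ler_nM2l ?invr_lt0 ?ler_ln.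
- exact: ab.
- exact: a0.
- exact: b0.
- exact: p_lt0.
Qed.

(** Two power sums differ by less than [M], so one more positive agent outweighs any change in
    them. *)
Lemma welfare_max M X : 2 * (n%:R * powbound) < M ->
  (forall Y, welfare c v (agent_welfare M) Y <= welfare c v (agent_welfare M)
    X) ->
  max_p_mean_welfare v p X.
Proof.
move=> M_large opt; split=> Y.
  rewrite leqNgt; apply/negP => ltXY; have := opt Y; rewrite !welfareE.
  have := powsum_bound X; have := powsum_bound Y; rewrite !ler_norml.
  move=> /andP[lY _] /andP[_ hX].
  have : #|positive_agents v X|%:R + 1 <= #|positive_agents v Y|%:R :> R.
    by rewrite natr1 ler_nat.
  have : 0 <= n%:R * powbound by rewrite mulr_ge0 // addr_ge0.
  nra.
by move=> eYX; apply: powsum_max => //; have := opt Y;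
  rewrite !welfareE eYX lerD2r.
Qed.

End PMeanYankeeSwap.

Theorem theorem6p3 (R : realType) (n : nat) (G : finType) (c : nat)
    (v : 'I_n -> {set G} -> R) (p : R)
    (hn : (0 < n)%N) (hc : (2 <= c)%N)
    (hv : forall i, oneC_SUB c (v i))
    (hp1 : p < 1) (hp0 : p != 0) :
  \forall M \near +oo,
    yankee_swap_computes c v (p_mean_gain v p M) (max_p_mean_welfare v p).
Proof.
(* The first bound gives the gain comparisons, the second the priority of the number of positive
   agents. *)
exists (Num.max (signed_pow p (1 + c)%:R - signed_pow p 1%:R + 1)
          (2 * (n%:R * powbound p c G))).
split=> [|M]; first exact: num_real.
rewrite gt_max => /andP[M_gain M_welfare].
apply: (@ys_correct R n G c v _ (agent_gain p M) (agent_welfare p M) hn hc hv).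
- exact: agent_welfare_mono M_gain.
- exact: agent_welfare_concave M_gain.
- by move=> X k u d; apply: p_mean_gainE.
- exact: agent_gain_cc M_gain.
- exact: agent_gain_1c M_gain.
- exact: agent_gain_11 M_gain.
- exact: agent_gain_c1 M_gain.
- by move=> X; apply: welfare_max.
Qed.
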